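(* Let $\mathbb{S}^1\subset\mathbb{R}^2$ be the unit circle endowed with the Riemannian metric $g$ induced from $\mathbb{R}^2$, and let $\boldsymbol{f}\in H^2(\mathbb{S}^1;\mathbb{R}^D)$. Then $$\text{the length of the curve }\boldsymbol{f}(\mathbb{S}^1)\;\le\;(2\pi)^{3/2}\,\|\nabla^2\boldsymbol{f}\|_{L^2(\mathbb{S}^1)}.$$
   Context: The length of the curve is $\int_0^{2\pi}\|\frac{d}{dt}\boldsymbol{f}(\cos t,\sin t)\|\,dt$. $\nabla$ is the Levi-Civita connection of $g$; for scalar $f$ the Hessian is $\nabla^2 f(u,v)=u(vf)-(\nabla_u v)f$; for $\boldsymbol{f}=(f_1,\dots,f_D)$, $\|\nabla^2\boldsymbol{f}\|_{L^2(\mathbb{S}^1)}^2=\sum_{j=1}^D\int_{\mathbb{S}^1}|\nabla^2 f_j|_g^2\,d\mathrm{vol}_g$ where $|T|_g^2=T(e,e)^2$ for a $g$-unit tangent vector $e$. $H^2(\mathbb{S}^1;\mathbb{R}^D)$ is the completion of $C^\infty(\mathbb{S}^1;\mathbb{R}^D)$ in the norm $(\|\boldsymbol{f}\|_{L^2}^2+\|\nabla^2\boldsymbol{f}\|_{L^2}^2)^{1/2}$; derivatives are understood weakly. *)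

(* Defs.v *)
From HB Require Import structures.
From mathcomp Require Import all_boot all_order all_algebra.
From mathcomp Require Import all_classical all_reals all_analysis.
From mathcomp Require Import ring lra.
Set Implicit Arguments.
Unset Strict Implicit.
Unset Printing Implicit Defensive.
Import Order.TTheory GRing.Theory Num.Theory.
Import numFieldNormedType.Exports.
Local Open Scope classical_set_scope.
Local Open Scope ring_scope.

Definition circle (R : realType) := {p : R * R | p.1 ^+ 2 + p.2 ^+ 2 == 1}.

Lemma circ_proof (R : realType) (t : R) : cos t ^+ 2 + sin t ^+ 2 == 1.
Proof. by rewrite cos2Dsin2. Qed.

Definition circ (R : realType) (t : R) : circle R :=
  exist _ (cos t, sin t) (circ_proof t).

Lemma rotate_proof (R : realType) (p : circle R) (s : R) :
  (cos s * (sval p).1 - sin s * (sval p).2) ^+ 2 +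
  (cos s * (sval p).2 + sin s * (sval p).1) ^+ 2 == 1.
Proof.
case: p => -[x y] /= /eqP xy; apply/eqP.
transitivity ((cos s ^+ 2 + sin s ^+ 2) * (x ^+ 2 + y ^+ 2)); first by ring.
by rewrite xy cos2Dsin2 mulr1.
Qed.

Definition rotate (R : realType) (p : circle R) (s : R) : circle R :=
  exist (fun q : R * R => q.1 ^+ 2 + q.2 ^+ 2 == 1)
    (cos s * (sval p).1 - sin s * (sval p).2,
     cos s * (sval p).2 + sin s * (sval p).1) (rotate_proof p s).

(* Tangent vectors are represented by their image in R^2, so that the induced
   metric is the restriction of this form to the tangent lines. *)
Definition g_metric (R : realType) (u v : R * R) : R := u.1 * v.1 + u.2 * v.2.

Definition unit_field (R : realType) (p : circle R) : R * R :=
  (- (sval p).2, (sval p).1).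

Definition smooth (R : realType) (F : R -> R) : Prop :=
  forall n t, derivable (derive1n n F) t 1.

(* [circ] is a local parametrization at every point of the circle. *)
Definition smoothS (R : realType) (phi : circle R -> R) : Prop :=
  smooth (phi \o @circ R).

Definition smooth_map (R : realType) (D : nat) (f : circle R -> 'rV[R]_D) :=
  forall j, smoothS (fun p => f p ord0 j).

Definition vfield (R : realType) (v : circle R -> R * R) : Prop :=
  [/\ forall p, g_metric (v p) (sval p) = 0,
      smoothS (fun p => (v p).1) & smoothS (fun p => (v p).2)].

(* [v phi]: derivative of [phi] at [p] along the curve
   [s |-> cos (a s) p + sin (a s) (unit_field p)], whose velocity at [s = 0]
   is [a (unit_field p) = v p]. *)
Definition dirD (R : realType) (v : circle R -> R * R) (phi : circle R -> R)
    (p : circle R) : R :=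
  derive1 (fun s => phi (rotate p (g_metric (v p) (unit_field p) * s))) 0.

Definition vadd (R : realType) (u v : circle R -> R * R) (p : circle R) :=
  ((u p).1 + (v p).1, (u p).2 + (v p).2).

Definition vscale (R : realType) (phi : circle R -> R) (v : circle R -> R * R)
    (p : circle R) := (phi p * (v p).1, phi p * (v p).2).

Definition vsub (R : realType) (u v : circle R -> R * R) (p : circle R) :=
  ((u p).1 - (v p).1, (u p).2 - (v p).2).

Definition connection (R : realType) :=
  (circle R -> R * R) -> (circle R -> R * R) -> (circle R -> R * R).

Record levi_civita (R : realType) (nabla : connection R) : Prop := LeviCivita {
  lc_vfield : forall u v, vfield u -> vfield v -> vfield (nabla u v);
  lc_addl : forall u v w, vfield u -> vfield v -> vfield w ->
    nabla (vadd u v) w = vadd (nabla u w) (nabla v w);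
  lc_scalel : forall phi u v, smoothS phi -> vfield u -> vfield v ->
    nabla (vscale phi u) v = vscale phi (nabla u v);
  lc_addr : forall u v w, vfield u -> vfield v -> vfield w ->
    nabla u (vadd v w) = vadd (nabla u v) (nabla u w);
  lc_leibniz : forall phi u v, smoothS phi -> vfield u -> vfield v ->
    nabla u (vscale phi v) = vadd (vscale (dirD u phi) v) (vscale phi (nabla u v));
  lc_metric : forall u v w, vfield u -> vfield v -> vfield w ->
    dirD u (fun p => g_metric (v p) (w p)) =
    (fun p => g_metric (nabla u v p) (w p) + g_metric (v p) (nabla u w p));
  (* nabla_u v - nabla_v u = [u, v] *)
  lc_torsion : forall u v phi, vfield u -> vfield v -> smoothS phi ->
    dirD (vsub (nabla u v) (nabla v u)) phi =
    (fun p => dirD u (dirD v phi) p - dirD v (dirD u phi) p) }.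

(* [levi_civita] is satisfiable: writing [v = b e] with [e = unit_field], the
   connection is [nabla_u v = (u b) e], since [nabla_u e = 0]. *)

Lemma circ_surj (R : realType) (p : circle R) : exists t, p = circ t.
Proof.
case: p => -[x y] xyP.
have /eqP /= xy := xyP.
have y2 : 0 <= y ^+ 2 by exact: sqr_ge0.
have x1 : -1 <= x <= 1.
  by rewrite -ler_norml -(@ler_pXn2r _ 2) ?nnegrE // real_normK ?num_real // expr1n; lra.
have sE : sin (acos x) = `|y|.
  rewrite sin_acos // -sqrtr_sqr; congr Num.sqrt.
  by rewrite -xy addrC addKr.
have [y0|y0] := leP 0 y.
  exists (acos x); apply: val_inj => /=.
  by rewrite acosK ?in_itv //= sE ger0_norm.
exists (- acos x); apply: val_inj => /=.
by rewrite cosN sinN acosK ?in_itv //= sE ltr0_norm // opprK.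
Qed.

Lemma rotate_circ (R : realType) (t s : R) : rotate (circ t) s = circ (t + s).
Proof.
apply: val_inj => /=; rewrite cosD sinD; congr (_, _); ring.
Qed.

Fixpoint ndiff (R : realType) (n : nat) (F : R -> R) : Prop :=
  (forall t, derivable F t 1) /\ if n is n'.+1 then ndiff n' (derive1 F) else True.

Lemma smoothP (R : realType) (F : R -> R) : smooth F <-> forall n, ndiff n F.
Proof.
have derS n (G : R -> R) : derive1n n.+1 G = derive1n n (derive1 G).
  by rewrite /derive1n iterSr.
split=> [sF n|].
  elim: n F sF => [|n IH] F sF /=; first by split=> // t; exact: (sF 0%N).
  split; first by move=> t; exact: (sF 0%N).
  by apply: IH => m t; rewrite -derS.
move=> dF n; elim: n F dF => [|n IH] F dF t; first by case: (dF 0%N).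
by rewrite derS; apply: IH => m; case: (dF m.+1).
Qed.

Lemma ndiffW (R : realType) n (F : R -> R) : ndiff n.+1 F -> ndiff n F.
Proof.
elim: n F => [|n IH] F [d1 d2]; first by split.
by split=> //; exact: IH.
Qed.

Lemma derive1_add (R : realType) (F G : R -> R) t :
  derivable F t 1 -> derivable G t 1 ->
  derive1 (fun x => F x + G x) t = derive1 F t + derive1 G t.
Proof. by move=> dF dG; rewrite !derive1E; exact: deriveD. Qed.

Lemma derive1_mul (R : realType) (F G : R -> R) t :
  derivable F t 1 -> derivable G t 1 ->
  derive1 (fun x => F x * G x) t = derive1 F t * G t + F t * derive1 G t.
Proof.
move=> dF dG; rewrite !derive1E.
have -> : 'D_1 (fun x => F x * G x) t = 'D_1 (F * G) t by [].
by rewrite deriveM // /GRing.scale /= addrC mulrC.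
Qed.

Lemma ndiffD (R : realType) n (F G : R -> R) :
  ndiff n F -> ndiff n G -> ndiff n (fun t => F t + G t).
Proof.
elim: n F G => [|n IH] F G [dF nF] [dG nG]; split => //.
- by move=> t; exact: derivableD.
- by move=> t; exact: derivableD.
- rewrite (_ : derive1 _ = fun t => derive1 F t + derive1 G t); first exact: IH.
  by apply/funext => t; rewrite derive1_add.
Qed.

Lemma ndiffM (R : realType) n (F G : R -> R) :
  ndiff n F -> ndiff n G -> ndiff n (fun t => F t * G t).
Proof.
elim: n F G => [|n IH] F G hF hG.
  by split=> // t; apply: derivableM; [case: hF|case: hG].
have [dF nF] := hF; have [dG nG] := hG.
split; first by move=> t; exact: derivableM.
rewrite (_ : derive1 _ = fun t => derive1 F t * G t + F t * derive1 G t).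
  by apply: ndiffD; apply: IH => //; exact: ndiffW.
by apply/funext => t; rewrite derive1_mul.
Qed.

Lemma smoothD (R : realType) (F G : R -> R) :
  smooth F -> smooth G -> smooth (fun t => F t + G t).
Proof. by move=> /smoothP sF /smoothP sG; apply/smoothP => n; exact: ndiffD. Qed.

Lemma smoothM (R : realType) (F G : R -> R) :
  smooth F -> smooth G -> smooth (fun t => F t * G t).
Proof. by move=> /smoothP sF /smoothP sG; apply/smoothP => n; exact: ndiffM. Qed.

Lemma smooth_cst (R : realType) (c : R) : smooth (fun _ : R => c).
Proof.
apply/smoothP => n; elim: n c => [|n IH] c; split; try by [].
rewrite (_ : derive1 _ = fun=> 0); first exact: IH.
by apply/funext => t; rewrite derive1_cst.
Qed.

Lemma smooth_derive1 (R : realType) (F : R -> R) : smooth F -> smooth (derive1 F).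
Proof. by move=> /smoothP sF; apply/smoothP => n; case: (sF n.+1). Qed.

Lemma smooth_cos_sin (R : realType) : smooth (@cos R) /\ smooth (@sin R).
Proof.
suff H n : ndiff n (@cos R) /\ ndiff n (@sin R).
  by split; apply/smoothP => n; case: (H n).
elim: n => [|n [Hc Hs]]; first by split; split=> // t; exact: ex_derive.
split; split; try by move=> t; exact: ex_derive.
- rewrite (_ : derive1 _ = fun t => -1 * sin t).
    by apply: ndiffM => //; apply: (smoothP _).1; exact: smooth_cst.
  by apply/funext => t; rewrite derive1E derive_val mulN1r.
- rewrite (_ : derive1 _ = cos) //.
  by apply/funext => t; rewrite derive1E derive_val.
Qed.

Definition ecoord (R : realType) (v : circle R -> R * R) (p : circle R) : R :=
  g_metric (v p) (unit_field p).

Lemma vfieldE (R : realType) (v : circle R -> R * R) : vfield v ->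
  v = vscale (ecoord v) (@unit_field R).
Proof.
case=> vt _ _; apply/funext => -[[x y] xyP].
have /eqP /= xy := xyP.
have := vt (exist _ (x, y) xyP); rewrite /vscale /ecoord /g_metric /unit_field /=.
case: (v _) => a b /= ab; congr (_, _).
  rewrite -[LHS]mulr1 -xy; transitivity ((a * x + b * y) * x + (a * - y + b * x) * - y).
    by ring.
  by rewrite ab mul0r add0r.
rewrite -[LHS]mulr1 -xy; transitivity ((a * x + b * y) * y + (a * - y + b * x) * x).
  by ring.
by rewrite ab mul0r add0r.
Qed.

Lemma g_metric_unit (R : realType) (p : circle R) :
  g_metric (unit_field p) (unit_field p) = 1.
Proof.
case: p => -[x y] xyP; have /eqP /= xy := xyP; by rewrite /g_metric /= mulrNN addrC -!expr2.
Qed.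

Lemma ecoord_scale (R : realType) (a : circle R -> R) :
  ecoord (vscale a (@unit_field R)) = a.
Proof.
apply/funext => p; rewrite /ecoord -[RHS]mulr1 -(g_metric_unit p) /g_metric /=.
ring.
Qed.

Lemma smoothS_ecoord (R : realType) (v : circle R -> R * R) :
  vfield v -> smoothS (ecoord v).
Proof.
move=> [_ v1 v2]; have [sc ss] := smooth_cos_sin R.
apply: (@smoothD _ (fun t => (v (circ t)).1 * - sin t) (fun t => (v (circ t)).2 * cos t)).
  apply: smoothM => //.
  rewrite (_ : (fun t => - sin t) = fun t : R => -1 * sin t).
    by apply: smoothM => //; exact: smooth_cst.
  by apply/funext => t; rewrite mulN1r.
by apply: smoothM.
Qed.

Lemma vfield_scale (R : realType) (a : circle R -> R) :
  smoothS a -> vfield (vscale a (@unit_field R)).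
Proof.
move=> sa; have [sc ss] := smooth_cos_sin R; split.
- by move=> p; rewrite /g_metric /vscale /=; ring.
- apply: (@smoothM _ (a \o @circ R) (fun t => - sin t)) => //.
  rewrite (_ : (fun t => - sin t) = fun t : R => -1 * sin t).
    by apply: smoothM => //; exact: smooth_cst.
  by apply/funext => t; rewrite mulN1r.
- exact: (@smoothM _ (a \o @circ R) (@cos R)).
Qed.

Lemma dirD_circ (R : realType) v (phi : circle R -> R) (t : R) : smoothS phi ->
  dirD v phi (circ t) = ecoord v (circ t) * derive1 (phi \o @circ R) t.
Proof.
move=> sphi; rewrite /dirD -/(ecoord v (circ t)).
set a := ecoord v (circ t).
rewrite (_ : (fun s => _) = (phi \o @circ R) \o (fun s => t + a * s)); last first.
  by apply/funext => s /=; rewrite rotate_circ.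
have dl : is_derive (0 : R) 1 (fun s => t + a * s) a.
  rewrite (_ : (fun s => _) = cst t + a \*: (@id R)) //.
  by apply: is_derive_eq; rewrite add0r /GRing.scale /= mulr1.
rewrite derive1_comp; first last.
- by rewrite mulr0 addr0; exact: (sphi 0%N).
- exact: ex_derive.
by rewrite (derive1E (fun s => t + a * s)) derive_val mulr0 addr0 mulrC.
Qed.

Lemma smoothS_dirD (R : realType) (v : circle R -> R * R) (phi : circle R -> R) :
  vfield v -> smoothS phi -> smoothS (dirD v phi).
Proof.
move=> hv sphi.
rewrite /smoothS (_ : _ \o _ =
    fun t => (ecoord v \o @circ R) t * derive1 (phi \o @circ R) t).
  by apply: smoothM; [exact: smoothS_ecoord|exact: smooth_derive1].
by apply/funext => t /=; rewrite dirD_circ.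
Qed.

Definition circle_lc (R : realType) : connection R :=
  fun u v => vscale (dirD u (ecoord v)) (@unit_field R).

Lemma dirDD (R : realType) u (phi psi : circle R -> R) :
  smoothS phi -> smoothS psi ->
  dirD u (fun p => phi p + psi p) = fun p => dirD u phi p + dirD u psi p.
Proof.
move=> s1 s2; apply/funext => p; have [t ->] := circ_surj p.
rewrite !dirD_circ //; last exact: smoothD.
rewrite -mulrDr; congr (_ * _).
by apply: derive1_add; [exact: (s1 0%N)|exact: (s2 0%N)].
Qed.

Lemma dirDM (R : realType) u (phi psi : circle R -> R) :
  smoothS phi -> smoothS psi ->
  dirD u (fun p => phi p * psi p) = fun p => dirD u phi p * psi p + phi p * dirD u psi p.
Proof.
move=> s1 s2; apply/funext => p; have [t ->] := circ_surj p.
rewrite !dirD_circ //; last exact: smoothM.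
transitivity (ecoord u (circ t) * (derive1 (phi \o @circ R) t * psi (circ t) +
    phi (circ t) * derive1 (psi \o @circ R) t)); last by ring.
congr (_ * _).
exact: (derive1_mul (s1 0%N t) (s2 0%N t)).
Qed.

Lemma ecoordD (R : realType) (u v : circle R -> R * R) :
  ecoord (vadd u v) = fun p => ecoord u p + ecoord v p.
Proof. by apply/funext => p; rewrite /ecoord /g_metric /=; ring. Qed.

Lemma ecoordM (R : realType) phi (v : circle R -> R * R) :
  ecoord (vscale phi v) = fun p => phi p * ecoord v p.
Proof. by apply/funext => p; rewrite /ecoord /g_metric /=; ring. Qed.

Lemma ecoordB (R : realType) (u v : circle R -> R * R) :
  ecoord (vsub u v) = fun p => ecoord u p - ecoord v p.
Proof. by apply/funext => p; rewrite /ecoord /g_metric /=; ring. Qed.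

Lemma g_metricE (R : realType) (v w : circle R -> R * R) : vfield v -> vfield w ->
  (fun p => g_metric (v p) (w p)) = fun p => ecoord v p * ecoord w p.
Proof.
move=> hv hw; apply/funext => p; rewrite {1}(vfieldE hv) {1}(vfieldE hw).
rewrite -[RHS]mulr1 -(g_metric_unit p) /g_metric /=; ring.
Qed.

Lemma circle_lc_levi_civita (R : realType) : levi_civita (@circle_lc R).
Proof.
have vlc u v : vfield u -> vfield v -> vfield (@circle_lc R u v).
  by move=> hu hv; apply: vfield_scale; apply: smoothS_dirD => //; exact: smoothS_ecoord.
split=> //.
- move=> u v w hu hv hw; apply/funext => p; rewrite /circle_lc /vscale /vadd /=.
  have [t ->] := circ_surj p; have sw := smoothS_ecoord hw.
  by rewrite !dirD_circ // ecoordD; congr (_, _); ring.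
- move=> phi u v sphi hu hv; apply/funext => p; rewrite /circle_lc /vscale /=.
  have [t ->] := circ_surj p; have sv := smoothS_ecoord hv.
  by rewrite !dirD_circ // -/(vscale phi u) ecoordM; congr (_, _); ring.
- move=> u v w hu hv hw; apply/funext => p; rewrite /circle_lc /vscale /vadd /=.
  rewrite -/(vadd v w) ecoordD dirDD; [|exact: smoothS_ecoord..].
  by congr (_, _); ring.
- move=> phi u v sphi hu hv; rewrite /circle_lc ecoordM dirDM //; last exact: smoothS_ecoord.
  rewrite {3}(vfieldE hv).
  by apply/funext => p; rewrite /vscale /vadd /=; congr (_, _); ring.
- move=> u v w hu hv hw; rewrite g_metricE // dirDM; [|exact: smoothS_ecoord..].
  apply/funext => p; have -> := congr1 (@^~ p) (g_metricE (vlc u v hu hv) hw).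
  have -> := congr1 (@^~ p) (g_metricE hv (vlc u w hu hw)).
  by rewrite /= !ecoord_scale.
- move=> u v phi hu hv sphi; apply/funext => p.
  have [su sv] := (smoothS_ecoord hu, smoothS_ecoord hv).
  pose e1 := dirD (@unit_field R) phi.
  have hE : vfield (@unit_field R).
    rewrite (_ : @unit_field R = vscale (fun=> 1) (@unit_field R)).
      by apply: vfield_scale; exact: smooth_cst.
    by apply/funext => q; rewrite /vscale !mul1r; case: (unit_field q).
  have dE w : dirD w phi = fun q => ecoord w q * e1 q.
    apply/funext => q; have [t ->] := circ_surj q.
    by rewrite /e1 !dirD_circ // /ecoord g_metric_unit mul1r.
  have se1 : smoothS e1 by exact: smoothS_dirD.
  rewrite !dE !dirDM // ecoordB !ecoord_scale.
  have [t ->] := circ_surj p; rewrite !dirD_circ //.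
  ring.
Qed.

Definition angles (R : realType) : set R := `[0, 2 * pi].

Definition circ_velocity (R : realType) (t : R) : R * R :=
  (derive1 (@cos R) t, derive1 (@sin R) t).

Definition vol_density (R : realType) (t : R) : R :=
  Num.sqrt (g_metric (circ_velocity t) (circ_velocity t)).

Definition integralS (R : realType) (h : circle R -> R) : \bar R :=
  (\int[lebesgue_measure]_(t in @angles R) (h (circ t) * vol_density t)%:E)%E.

Definition integrableS (R : realType) (h : circle R -> R) : Prop :=
  lebesgue_measure.-integrable (@angles R)
    (fun t : R => (h (circ t) * vol_density t)%:E).

(* The norm of the library on ['rV[R]_D] is the sup norm. *)
Definition enorm (R : realType) (D : nat) (x : 'rV[R]_D) : R :=
  Num.sqrt (\sum_(j < D) x ord0 j ^+ 2).

Definition L2norm (R : realType) (D : nat) (f : circle R -> 'rV[R]_D) : \bar R :=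
  (integralS (fun p => (enorm (f p) ^+ 2)%R) `^ 2^-1)%E.

Definition inL2 (R : realType) (D : nat) (f : circle R -> 'rV[R]_D) : Prop :=
  (forall j, measurable_fun (@angles R) (fun t : R => f (circ t) ord0 j)) /\
  (L2norm f < +oo)%E.

Definition divergence (R : realType) (nabla : connection R)
    (v : circle R -> R * R) (p : circle R) : R :=
  g_metric (nabla (@unit_field R) v p) (unit_field p).

(* [phi |-> - div (phi v)] is the formal adjoint of [f |-> v f] for dvol_g. *)
Definition is_wdirD (R : realType) (nabla : connection R)
    (v : circle R -> R * R) (f h : circle R -> R) : Prop :=
  [/\ integrableS f, integrableS h &
      forall phi, smoothS phi ->
        integralS (fun p => h p * phi p) =
        (- integralS (fun p => (f p * divergence nabla (vscale phi v) p)%R))%E].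

Definition wdirD (R : realType) (nabla : connection R)
    (v : circle R -> R * R) (f : circle R -> R) : circle R -> R :=
  xget (fun=> 0 : R) [set h : circle R -> R | is_wdirD nabla v f h].

(* [der v f] stands for [v f]; it is either [dirD] or [wdirD nabla]. *)
Definition hessian (R : realType) (nabla : connection R)
    (der : (circle R -> R * R) -> (circle R -> R) -> circle R -> R)
    (f : circle R -> R) (u v : circle R -> R * R) (p : circle R) : R :=
  der u (der v f) p - der (nabla u v) f p.

Definition hess_L2norm (R : realType) (D : nat) (nabla : connection R)
    (der : (circle R -> R * R) -> (circle R -> R) -> circle R -> R)
    (f : circle R -> 'rV[R]_D) : \bar R :=
  ((\sum_(j < D) integralS (fun p =>
      (hessian nabla der (fun q => f q ord0 j)
         (@unit_field R) (@unit_field R) p) ^+ 2)%R) `^ 2^-1)%E.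

Definition H2norm (R : realType) (D : nat) (nabla : connection R)
    (f : circle R -> 'rV[R]_D) : \bar R :=
  ((L2norm f ^+ 2 + hess_L2norm nabla (@dirD R) f ^+ 2) `^ 2^-1)%E.

(* An element of the completion is identified with the L^2 limit of any
   Cauchy sequence of smooth maps representing it. *)
Definition inH2 (R : realType) (D : nat) (nabla : connection R)
    (f : circle R -> 'rV[R]_D) : Prop :=
  inL2 f /\
  exists F : nat -> circle R -> 'rV[R]_D,
    [/\ forall n, smooth_map (F n),
        forall eps : R, 0 < eps -> exists N, forall m n,
          (N <= m)%N -> (N <= n)%N ->
          (H2norm nabla (fun p => (F m p - F n p)%R) < eps%:E)%E &
        (fun n => L2norm (fun p => F n p - f p)) @ \oo --> 0%E].

(* For [2 * pi]-periodic [F]; periodic test functions are those of the circle. *)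
Definition is_wderiv (R : realType) (D : nat) (F W : R -> 'rV[R]_D) : Prop :=
  forall j : 'I_D,
  [/\ lebesgue_measure.-integrable (@angles R) (fun t : R => (F t ord0 j)%:E),
      lebesgue_measure.-integrable (@angles R) (fun t : R => (W t ord0 j)%:E) &
      forall phi : R -> R, smooth phi -> (forall t, phi (t + 2 * pi) = phi t) ->
        (\int[lebesgue_measure]_(t in @angles R) (W t ord0 j * phi t)%:E =
         - \int[lebesgue_measure]_(t in @angles R)
             (F t ord0 j * derive1 phi t)%:E)%E].

(* The value is +oo if [f] has no integrable weak derivative. *)
Definition curve_length (R : realType) (D : nat) (f : circle R -> 'rV[R]_D) :
    \bar R :=
  let F : R -> 'rV[R]_D := f \o @circ R in
  let W := xget (fun=> 0 : 'rV[R]_D) [set W : R -> 'rV[R]_D | is_wderiv F W] in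
  if `[< is_wderiv F W >]
  then (\int[lebesgue_measure]_(t in @angles R) (enorm (W t))%:E)%E
  else +oo%E.

(* Main.v *)
Require Import Defs.
From mathcomp Require Import all_boot all_order all_algebra.
From mathcomp Require Import all_classical all_reals all_analysis measurable_realfun.
From mathcomp Require Import ring lra.
Set Implicit Arguments.
Unset Strict Implicit.
Unset Printing Implicit Defensive.
Import Order.TTheory GRing.Theory Num.Theory.
Import numFieldNormedType.Exports.
Local Open Scope classical_set_scope.
Local Open Scope ring_scope.

(** The bound is a one-dimensional Poincare inequality.  Write [e] for the unit
tangent field, so that [e] acts on functions as [d/dt].  The Levi-Civita
connection satisfies [nabla e e = 0] ([nabla_unit]): it is tangent, and it is
orthogonal to [e] because [g(e, e)] is constant.  Hence the Hessian of a
component [u] evaluated at [(e, e)] is [u''].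

For a smooth periodic [u], Rolle gives a zero of [u'], so that
[|u'(t)| <= int |u''|] for all [t] ([derive1_le_int_norm]).  By Cauchy-Schwarz
[(int |u''|)^2 <= 2 pi int |u''|^2] ([sqr_L1_le_L2]), and summing the squares
over the components bounds the speed pointwise by [sqrt (2 pi)] times the [L^2]
norm of the Hessian; integrating over an interval of length [2 pi] produces the
factor [(2 pi)^(3/2)].

For a map [f] in [H^2] both sides of the inequality are defined by arbitrary
choices of weak derivatives, so existence and uniqueness of those derivatives
have to be established.

Existence ([inH2_weak_derivatives]): along a fast subsequence of the
approximating smooth maps the second derivatives are summably Cauchy in [L^1];
the pointwise bound above transfers this to the first derivatives.  Such
sequences converge almost everywhere and in [L^1] ([fast_L1_cauchy_cvg]), and
integration by parts passes to the limit ([second_wderiv_limit]).  The same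
passage to the limit preserves the estimate [|u'| <= int |u''|].

Uniqueness almost everywhere ([circle_test_ae_eq]) is the fundamental lemma of
the calculus of variations on the circle.  The smooth test functions
[1 / (1 + exp (- n q))], where [q] is a trigonometric polynomial positive exactly
on the arc [(0, x)], converge boundedly to the indicator of that arc; therefore
the primitive of the difference of two weak derivatives vanishes, and so does
the difference by Lebesgue differentiation ([circle_test_ae0]). *)

(** * L1 limits of fast Cauchy sequences *)

Lemma summable_increments_cvg (R : realType) (a : nat -> R) :
  (\sum_(k <oo) `|(a k.+1 - a k)%:E| < +oo)%E -> cvgn a.
Proof.
move=> S.
suff cs : cvgn (series (fun k => a k.+1 - a k)).
  rewrite (_ : a = fun k => a 0%N + series (fun k => a k.+1 - a k) k).
    by apply: is_cvgD => //; exact: is_cvg_cst.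
  apply/funext => k; rewrite /series /= telescope_sumr //.
  by rewrite addrC subrK.
apply: normed_cvg.
apply: nondecreasing_is_cvgn.
  apply: nondecreasing_series => n _ _; exact: normr_ge0.
exists (fine (\sum_(k <oo) `|(a k.+1 - a k)%:E|)%E).
move=> _ [n _ <-].
rewrite -lee_fin fineK; last first.
  by rewrite ge0_fin_numE // nneseries_ge0.
rewrite /series /= -sumEFin.
by apply: (nneseries_lim_ge (P := xpredT) (m := 0%N)
  (u_ := fun k => `|(a k.+1 - a k)%:E|%E)).
Qed.

Section L1.
Context d (T : measurableType d) (R : realType).
Variables (mu : {measure set T -> \bar R}) (D : set T).
Hypothesis mD : measurable D.

Lemma integrable_EFinB (f g : T -> R) :
  mu.-integrable D (EFin \o f) -> mu.-integrable D (EFin \o g) ->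
  mu.-integrable D (EFin \o (fun x => f x - g x)).
Proof. by move=> intf intg; have := integrableB mD intf intg. Qed.

Lemma integrable_EFin_norm (f : T -> R) :
  mu.-integrable D (EFin \o f) -> mu.-integrable D (EFin \o (fun x => `|f x|)).
Proof. by move=> /integrable_abse. Qed.

Lemma integrable_EFinM (f phi : T -> R) (M : R) :
  mu.-integrable D (EFin \o f) -> measurable_fun D phi ->
  (forall x, D x -> `|phi x| <= M) ->
  mu.-integrable D (EFin \o (fun x => f x * phi x)).
Proof.
move=> intf mphi phiM.
have /measurable_EFinP mf := measurable_int mu intf.
apply: (@le_integrable _ _ _ mu D mD _ (fun x => (f x)%:E * M%:E)%E).
- by apply/measurable_EFinP; exact: measurable_funM.
- move=> x Dx; rewrite /= lee_fin !normrM ler_wpM2l //.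
  by rewrite (le_trans (phiM _ Dx)) // ler_norm.
- exact: integrableZr.
Qed.

(** Riesz-Fischer for [L^1].  The sum [S] of the absolute increments has finite
integral, so it is finite almost everywhere; there the sequence converges, and
[|g 0| + S] dominates it.  The limit is written with [limn_esup] because that
expression is measurable and defined at every point. *)
Lemma fast_L1_cauchy_cvg (g : nat -> T -> R) (C : R) :
  (forall k, mu.-integrable D (EFin \o g k)) ->
  (forall k, \int[mu]_(x in D) `|g k.+1 x - g k x| <= C / 2 ^+ k) ->
  let G x := fine (limn_esup (fun k => (g k x)%:E)) in
  [/\ mu.-integrable D (EFin \o G),
      {ae mu, forall x, D x -> g k x @[k --> \oo] --> G x} &
      \int[mu]_(x in D) `|g k x - G x| @[k --> \oo] --> (0 : R)].
Proof.
move=> ig gC G.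
have mg k : measurable_fun D (g k).
  by apply/measurable_EFinP; exact: (measurable_int mu (ig k)).
pose dg k x := `|(g k.+1 x - g k x)%:E|%E.
have idg k : mu.-integrable D (dg k).
  exact: (integrable_EFin_norm (integrable_EFinB (ig k.+1) (ig k))).
have mdg k : measurable_fun D (dg k) by exact: (measurable_int mu (idg k)).
pose S x := (\sum_(k <oo) dg k x)%E.
have dg0 k x : (0 <= dg k x)%E by exact: abse_ge0.
have S0 x : (0 <= S x)%E by apply: nneseries_ge0 => *; exact: dg0.
have mS : measurable_fun D S.
  by apply: ge0_emeasurable_sum => //.
have iS : mu.-integrable D S.
  apply/integrableP; split => //.
  under eq_integral do rewrite gee0_abs //.
  rewrite integral_nneseries //.
  have C0 : 0 <= C.
    have := gC 0%N; rewrite expr0 divr1; apply: le_trans.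
    by apply: Rintegral_ge0.
  apply: (@le_lt_trans _ _ (\sum_(k <oo) (C / 2 ^+ k)%:E)%E); last first.
    rewrite (_ : (fun k => _) = (fun n => (series (geometric C 2^-1) n)%:E)).
      rewrite EFin_lim; first by rewrite ltry.
      by apply: is_cvg_geometric_series; rewrite ger0_norm // invf_lt1 // ltr1n.
    apply/funext => n; rewrite /series /= -sumEFin.
    by apply: eq_bigr => k _; rewrite exprVn.
  apply: lee_nneseries => [k _ _|k _].
    by apply: integral_ge0.
  move: (gC k); rewrite -lee_fin; apply: le_trans.
  rewrite /Rintegral fineK //; apply: integrable_fin_num => //.
  by have := idg k.
have gS x : (S x < +oo)%E -> g k x @[k --> \oo] --> G x.
  move=> Sx; have cg := summable_increments_cvg Sx.
  have ecg : cvgn (fun k => (g k x)%:E).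
    by apply/cvg_ex; exists (limn (g^~ x))%:E; apply: cvg_EFin => //; exact: nearW.
  rewrite /G is_cvg_limn_esupE // EFin_lim //.
have aeS : {ae mu, forall x, D x -> (S x < +oo)%E}.
  have := integrable_ae mD iS; apply: filterS => x /[apply].
  by rewrite ge0_fin_numE.
have aeG : {ae mu, forall x, D x -> g k x @[k --> \oo] --> G x}.
  by move: aeS; apply: filterS => x /[apply]; exact: gS.
have mG : measurable_fun D (EFin \o G).
  apply/measurable_EFinP; apply: measurableT_comp => //.
  apply: measurable_fun_limn_esup => k; exact/measurable_EFinP.
pose h x := (`|(g 0%N x)%:E| + S x)%E.
have ih : mu.-integrable D h.
  by apply: integrableD => //; apply: integrable_abse; exact: ig.
have gh x n : (`|(g n x)%:E| <= h x)%E.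
  have : (`|g n x| <= `|g 0%N x| + \sum_(0 <= k < n) `|g k.+1 x - g k x|).
    rewrite -{1}(subrK (g 0%N x) (g n x)) addrC.
    apply: le_trans (ler_normD _ _) _; rewrite lerD2l.
    rewrite -(@telescope_sumr _ 0 n (g^~ x)) //; exact: ler_norm_sum.
  rewrite -lee_fin => /le_trans; apply.
  rewrite EFinD leeD2l // -sumEFin.
  exact: (nneseries_lim_ge (P := xpredT) (m:=0%N) (u_ := fun k => dg k x)).
have aeG' : {ae mu, forall x, D x -> (EFin \o g k) x @[k --> \oo] --> (EFin \o G) x}.
  by move: aeG; apply: filterS => x /[apply] gGx; apply: cvg_EFin => //; exact: nearW.
have aegh : {ae mu, forall x n, D x -> (`|(EFin \o g n) x| <= h x)%E}.
  by apply: aeW => x n _; exact: gh.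
have [iG cG _] := dominated_convergence mD
  (fun k => measurable_int mu (ig k)) mG aeG' ih aegh.
split => //.
have : fine (\int[mu]_(x in D) `|(EFin \o g k) x - (EFin \o G) x|)%E @[k --> \oo] --> fine 0%:E.
  by apply: fine_cvg.
exact.
Qed.

Lemma L1_test_cvg (g : nat -> T -> R) (G phi : T -> R) (M : R) :
  (forall k, mu.-integrable D (EFin \o g k)) -> mu.-integrable D (EFin \o G) ->
  measurable_fun D phi -> (forall x, D x -> `|phi x| <= M) ->
  \int[mu]_(x in D) `|g k x - G x| @[k --> \oo] --> (0 : R) ->
  \int[mu]_(x in D) (g k x * phi x) @[k --> \oo] --> \int[mu]_(x in D) (G x * phi x).
Proof.
move=> ig iG mphi phiM gG.
have iB k := integrable_EFinB (ig k) iG.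
apply/subr_cvg0.
apply: (@squeeze_cvgr _ _ _ _
  (fun k => - (\int[mu]_(x in D) `|g k x - G x| * M))
  (fun k => (\int[mu]_(x in D) `|g k x - G x| * M))).
- apply: nearW => k; rewrite -ler_norml -RintegralB //; [|exact: (integrable_EFinM _ mphi phiM)..].
  under eq_Rintegral do rewrite -mulrBl.
  apply: le_trans (le_normr_Rintegral _ _) _ => //.
    exact: (integrable_EFinM (iB k) mphi phiM).
  rewrite -RintegralZr //; last exact: integrable_EFin_norm.
  apply: le_Rintegral => //.
  + by apply: integrable_EFin_norm; exact: (integrable_EFinM (iB k) mphi phiM).
  + exact: (@integrableZr _ _ _ mu D mD M _ (integrable_EFin_norm (iB k))).
  + by move=> x Dx; rewrite normrM ler_wpM2l // phiM.
- by rewrite -oppr0 -(mul0r M); apply: cvgN; apply: cvgMl.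
- by rewrite -[X in _ --> X](mul0r M); apply: cvgMl.
Qed.

End L1.

(** * Smooth periodic functions *)

Section SmoothPeriodic.
Variable R : realType.
Notation mu := (@lebesgue_measure R).
Implicit Types u phi : R -> R.

Lemma twopi_gt0 : 0 < 2 * pi :> R.
Proof. by rewrite mulr_gt0 // pi_gt0. Qed.

Lemma measurable_angles : @measurable _ (measurableTypeR R) (@angles R).
Proof. exact: measurable_itv. Qed.

Lemma measure_angles : mu (@angles R) = (2 * pi)%:E.
Proof. by rewrite lebesgue_measure_itv /= lte_fin twopi_gt0 oppr0 adde0. Qed.

Lemma Rintegral_angles_cst (c : R) : \int[mu]_(_ in @angles R) c = c * (2 * pi).
Proof.
rewrite Rintegral_cst; last exact: measurable_angles.
by congr (_ * _); exact: (congr1 fine measure_angles).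
Qed.

Lemma smooth_continuous u : smooth u -> continuous u.
Proof.
move=> su t; apply: differentiable_continuous.
by apply/derivable1_diffP; exact: (su 0%N).
Qed.

Lemma smooth_integrable u : smooth u -> mu.-integrable (@angles R) (EFin \o u).
Proof.
move=> su; apply: continuous_compact_integrable; first exact: segment_compact.
by apply: continuous_subspaceT; exact: smooth_continuous.
Qed.

Lemma smooth_measurable u (D : set R) : smooth u ->
  measurable_fun (D : set (measurableTypeR R)) u.
Proof.
move=> su; apply: measurable_funTS; apply: continuous_measurable_fun.
exact: smooth_continuous.
Qed.

Lemma smooth_bounded u : smooth u ->
  exists M, forall t, (@angles R) t -> `|u t| <= M.
Proof.
move=> su.
have cu : {within (@angles R), continuous u}.
  by apply: continuous_subspaceT; exact: smooth_continuous.
have /compact_bounded[M [_ HM]] := continuous_compact cu (@segment_compact R 0 (2 * pi)).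
by exists (M + 1) => t It; apply: (HM (M + 1)); [rewrite ltrDl|exists t].
Qed.

Lemma smooth_sub u phi : smooth u -> smooth phi -> smooth (fun t => u t - phi t).
Proof.
move=> su sphi.
have -> : (fun t => u t - phi t) = fun t => u t + (-1) * phi t.
  by apply/funext => t; rewrite mulN1r.
exact: (@smoothD _ _ _ su (@smoothM _ _ _ (@smooth_cst _ (-1)) sphi)).
Qed.

Lemma derive1_sub u phi : smooth u -> smooth phi ->
  derive1 (fun t => u t - phi t) = fun t => derive1 u t - derive1 phi t.
Proof.
move=> su sphi; apply/funext => t; rewrite !derive1E.
exact: (deriveB (su 0%N t) (sphi 0%N t)).
Qed.

Lemma periodic_derive1 u : smooth u -> periodic u (2 * pi) ->
  periodic (derive1 u) (2 * pi).
Proof.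
move=> su pu t; rewrite -[in RHS](_ : (u \o (fun s => s + 2 * pi)) = u); last first.
  by apply/funext => s /=; rewrite pu.
have ds : is_derive t 1 (fun s : R => s + 2 * pi) 1.
  rewrite -[X in is_derive _ _ _ X]addr0.
  exact: (is_deriveD (is_derive_id t 1) (is_derive_cst (2 * pi) t 1)).
rewrite (@derive1_comp _ (fun s => s + 2 * pi) u); [|exact: ex_derive|exact: (su 0%N)].
rewrite [X in _ = _ * X]derive1E.
have -> := @derive_val _ _ _ _ _ _ _ ds.
by rewrite mulr1.
Qed.

Lemma smooth_FTC2 u (a b : R) : smooth u -> a <= b ->
  \int[mu]_(t in `[a, b]) derive1 u t = u b - u a.
Proof.
move=> su; rewrite le_eqVlt => /predU1P[->|ab].
  by rewrite set_itv1 Rintegral_set1 subrr.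
rewrite /Rintegral (@continuous_FTC2 _ _ u) //.
  by apply: continuous_subspaceT; apply: smooth_continuous; exact: smooth_derive1.
split.
- by move=> x _; exact: (su 0%N).
- by apply: cvg_at_right_filter; exact: smooth_continuous.
- by apply: cvg_at_left_filter; exact: smooth_continuous.
Qed.

Lemma smooth_by_parts u phi : smooth u -> periodic u (2 * pi) ->
  smooth phi -> periodic phi (2 * pi) ->
  \int[mu]_(t in @angles R) (derive1 u t * phi t) =
  - \int[mu]_(t in @angles R) (u t * derive1 phi t).
Proof.
move=> su pu sphi pphi; apply/eqP; rewrite -subr_eq0 opprK.
rewrite -RintegralD; [|exact: measurable_angles
  |exact: (smooth_integrable (smoothM (smooth_derive1 su) sphi))
  |exact: (smooth_integrable (smoothM su (smooth_derive1 sphi)))].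
have -> : (fun t => derive1 u t * phi t + u t * derive1 phi t) =
    derive1 (fun t => u t * phi t).
  by apply/funext => t; rewrite derive1_mul //; [exact: (su 0%N)|exact: (sphi 0%N)].
rewrite smooth_FTC2; [|exact: smoothM|exact/ltW/twopi_gt0].
by rewrite -[2 * pi]add0r pu pphi subrr.
Qed.

Lemma periodic_derive1_zero u : smooth u -> periodic u (2 * pi) ->
  exists2 s, (@angles R) s & derive1 u s = 0.
Proof.
move=> su pu.
have [s sI ds] : exists2 s, s \in `]0, (2 * pi)[%R & is_derive s 1 u 0.
  apply: Rolle; first exact: twopi_gt0.
  - by move=> x _; exact: (su 0%N).
  - by apply: continuous_subspaceT; exact: smooth_continuous.
  - by rewrite -[2 * pi]add0r pu.
exists s; last by rewrite derive1E derive_val.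
by apply: subset_itv_oo_cc.
Qed.

(** The derivative vanishes at some point [s], and [u' t] is the integral of
[u''] between [s] and [t]. *)
Lemma derive1_le_int_norm u t : smooth u -> periodic u (2 * pi) -> (@angles R) t ->
  `|derive1 u t| <= \int[mu]_(s in @angles R) `|derive1 (derive1 u) s|.
Proof.
move=> su pu It; have [s Is us0] := periodic_derive1_zero su pu.
have su1 := smooth_derive1 su; have su2 := smooth_derive1 su1.
have int2 := smooth_integrable su2.
have H a b : (@angles R) a -> (@angles R) b -> a <= b ->
    `|derive1 u b - derive1 u a| <= \int[mu]_(s in @angles R) `|derive1 (derive1 u) s|.
  move=> Ia Ib ab; rewrite -smooth_FTC2 //.
  have sub : `[a, b] `<=` @angles R.
    move: Ia Ib; rewrite /angles /= !in_itv /= => /andP[a0 _] /andP[_ b2] x /=.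
    by rewrite !in_itv /= => /andP[ax xb]; rewrite (le_trans a0 ax) (le_trans xb b2).
  have iab : mu.-integrable `[a, b] (EFin \o derive1 (derive1 u)).
    exact: (integrableS measurable_angles (measurable_itv _) sub int2).
  apply: le_trans (le_normr_Rintegral _ iab) _ => //.
  rewrite /Rintegral; apply: fine_le.
  - by apply: integrable_fin_num => //; exact: (integrable_EFin_norm iab).
  - by apply: integrable_fin_num; [exact: measurable_angles|exact: (integrable_EFin_norm int2)].
  - apply: ge0_subset_integral => //; first exact: measurable_angles.
    by apply/measurable_EFinP; apply: measurableT_comp => //; exact: smooth_measurable.
have [st|/ltW ts] := leP s t.
  by have := H _ _ Is It st; rewrite us0 subr0.
by have := H _ _ It Is ts; rewrite us0 sub0r normrN.
Qed.

End SmoothPeriodic.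

(** * Weak derivatives of L1 limits *)

Section WeakLimit.
Variable R : realType.
Notation mu := (@lebesgue_measure R).

(** [w] is the derivative of [f] as a distribution on the circle, both being
given by their restrictions to one period. *)
Definition wderiv (f w : R -> R) : Prop :=
  [/\ mu.-integrable (@angles R) (EFin \o f),
      mu.-integrable (@angles R) (EFin \o w) &
      forall phi, smooth phi -> periodic phi (2 * pi) ->
        \int[mu]_(t in @angles R) (w t * phi t) =
        - \int[mu]_(t in @angles R) (f t * derive1 phi t)].

Lemma wderiv_L1_limit (u : nat -> R -> R) (f w : R -> R) :
  (forall n, smooth (u n)) -> (forall n, periodic (u n) (2 * pi)) ->
  mu.-integrable (@angles R) (EFin \o f) -> mu.-integrable (@angles R) (EFin \o w) ->
  \int[mu]_(t in @angles R) `|u k t - f t| @[k --> \oo] --> (0 : R) ->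
  \int[mu]_(t in @angles R) `|derive1 (u k) t - w t| @[k --> \oo] --> (0 : R) ->
  wderiv f w.
Proof.
move=> su pu intf intw uf u'w; split => // phi sphi pphi.
have sphi' := smooth_derive1 sphi.
have [M HM] := smooth_bounded sphi.
have [M' HM'] := smooth_bounded sphi'.
have mA := @measurable_angles R.
have c1 := @L1_test_cvg _ _ _ mu _ mA _ _ _ _
  (fun k => smooth_integrable (smooth_derive1 (su k))) intw
  (@smooth_measurable R _ _ sphi) HM u'w.
have c2 := @L1_test_cvg _ _ _ mu _ mA _ _ _ _
  (fun k => smooth_integrable (su k)) intf
  (@smooth_measurable R _ _ sphi') HM' uf.
apply: cvg_unique c1 _ => //.
have -> : (fun k => \int[mu]_(t in @angles R) (derive1 (u k) t * phi t)) =
    (fun k => - \int[mu]_(t in @angles R) (u k t * derive1 phi t)).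
  by apply/funext => k; exact: (smooth_by_parts (su k) (pu k) sphi pphi).
exact: cvgN.
Qed.

(** Only the second derivatives and the functions themselves are assumed to
converge: increments of [u k] are smooth and periodic, so the increments of the
first derivatives are bounded uniformly by the [L^1] norms of those of the
second.  The functions [u1] and [u2] stand for the first and second derivatives
so that the limits can be read off sequences of functions on the circle. *)
Lemma second_wderiv_limit (u u1 u2 : nat -> R -> R) (f : R -> R) (C : R) :
  (forall k, u1 k = derive1 (u k)) -> (forall k, u2 k = derive1 (u1 k)) ->
  (forall n, smooth (u n)) -> (forall n, periodic (u n) (2 * pi)) ->
  mu.-integrable (@angles R) (EFin \o f) ->
  \int[mu]_(t in @angles R) `|u k t - f t| @[k --> \oo] --> (0 : R) ->
  (forall k, \int[mu]_(t in @angles R)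
     `|u2 k.+1 t - u2 k t| <= C / 2 ^+ k) ->
  let w t := fine (limn_esup (fun k => (u1 k t)%:E)) in
  let G t := fine (limn_esup (fun k => (u2 k t)%:E)) in
  [/\ wderiv f w, wderiv w G &
      {ae mu, forall t, (@angles R) t ->
         `|w t| <= \int[mu]_(s in @angles R) `|G s|}].
Proof.
move=> Eu1 Eu2.
have -> : u2 = fun k => derive1 (derive1 (u k)) by apply/funext => k; rewrite Eu2 Eu1.
have -> : u1 = fun k => derive1 (u k) by exact/funext.
move=> su pu intf uf u2C w G {Eu1 Eu2 u1 u2}.
have mA := @measurable_angles R.
have su1 k := smooth_derive1 (su k); have su2 k := smooth_derive1 (su1 k).
have pu1 k := periodic_derive1 (su k) (pu k).
have i1 k := smooth_integrable (su1 k); have i2 k := smooth_integrable (su2 k).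
have u1C k : \int[mu]_(t in @angles R) `|derive1 (u k.+1) t - derive1 (u k) t| <=
    (C * (2 * pi)) / 2 ^+ k.
  have H t : (@angles R) t -> `|derive1 (u k.+1) t - derive1 (u k) t| <= C / 2 ^+ k.
    move=> It.
    have pv : periodic (fun t => u k.+1 t - u k t) (2 * pi) by move=> s; rewrite !pu.
    have := derive1_le_int_norm (smooth_sub (su k.+1) (su k)) pv It.
    rewrite (derive1_sub (su k.+1) (su k)) (derive1_sub (su1 k.+1) (su1 k)).
    by move=> /le_trans; apply; exact: u2C.
  apply: le_trans (_ : \int[mu]_(t in @angles R) (C / 2 ^+ k) <= _).
    apply: le_Rintegral => //.
      exact: (integrable_EFin_norm (integrable_EFinB mA (i1 k.+1) (i1 k))).
    exact: (smooth_integrable (@smooth_cst R _)).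
  by rewrite Rintegral_angles_cst mulrAC.
have [iw aew cw] := fast_L1_cauchy_cvg mA i1 u1C.
have [iG _ cG] := fast_L1_cauchy_cvg mA i2 u2C.
split.
- exact: (wderiv_L1_limit su pu intf iw uf cw).
- exact: (wderiv_L1_limit su1 pu1 iw iG cw cG).
move: aew; apply: filterS => t /[swap] It /(_ It) wt.
have H k : `|derive1 (u k) t| <= \int[mu]_(s in @angles R) `|derive1 (derive1 (u k)) s - G s| +
    \int[mu]_(s in @angles R) `|G s|.
  apply: le_trans (derive1_le_int_norm (su k) (pu k) It) _.
  have iB := integrable_EFin_norm (integrable_EFinB mA (i2 k) iG).
  have iN := integrable_EFin_norm iG.
  rewrite -RintegralD //; apply: le_Rintegral => //.
  - exact: (integrable_EFin_norm (i2 k)).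
  - by have := integrableD mA iB iN.
  - by move=> s _; rewrite -{1}(subrK (G s) (derive1 (derive1 (u k)) s)) ler_normD.
have c1 : `|derive1 (u k) t| @[k --> \oo] --> `|w t| by exact: cvg_norm.
have c2 : \int[mu]_(s in @angles R) `|derive1 (derive1 (u k)) s - G s| +
    \int[mu]_(s in @angles R) `|G s| @[k --> \oo] -->
    \int[mu]_(s in @angles R) `|G s|.
  by rewrite -[X in _ --> X]add0r; apply: cvgD => //; exact: cvg_cst.
by apply: ler_cvg_to c1 c2 _; exact: nearW.
Qed.

End WeakLimit.

(** * The fundamental lemma of the calculus of variations on the circle *)

Section Fundamental.
Variable R : realType.
Notation mu := (@lebesgue_measure R).

(** A smooth step: its rescalings [logistic (n%:R * x)] tend to the indicator of
the positive half-line away from the origin, and the equation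
[s' = s (1 - s)] makes smoothness an immediate induction. *)
Definition logistic (x : R) : R := (1 + expR (- x))^-1.

Lemma logistic_den_gt0 (x : R) : 0 < 1 + expR (- x).
Proof. by rewrite addr_gt0 // expR_gt0. Qed.

Lemma logistic_ge0 x : 0 <= logistic x.
Proof. by rewrite invr_ge0 ltW // logistic_den_gt0. Qed.

Lemma logistic_le1 x : logistic x <= 1.
Proof. by rewrite invf_le1 ?logistic_den_gt0 // lerDl ltW // expR_gt0. Qed.

Lemma subr1_logistic x : 1 - logistic x = logistic (- x).
Proof.
rewrite /logistic opprK expRN.
have x0 := expR_gt0 x; field.
by rewrite ?lt0r_neq0 // addr_gt0.
Qed.

Lemma logistic_le_expR x : logistic x <= expR x.
Proof.
rewrite /logistic -[expR x]invrK -expRN lef_pV2 ?posrE ?expR_gt0 ?logistic_den_gt0 //.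
by rewrite lerDr.
Qed.

Lemma is_derive_logistic (x : R) :
  is_derive x 1 logistic (logistic x * (1 - logistic x)).
Proof.
have dN : is_derive x 1 (fun y : R => - y) (-1).
  by exact: (is_deriveN (is_derive_id x 1)).
have dE : is_derive x 1 (fun y : R => expR (- y)) (- expR (- x)).
  have := is_derive1_comp (is_derive_expR (- x)) dN.
  by rewrite mulrN1.
have dD : is_derive x 1 (fun y : R => 1 + expR (- y)) (- expR (- x)).
  rewrite -[X in is_derive _ _ _ X]add0r.
  exact: (@is_deriveD _ _ _ _ _ _ _ _ _ (is_derive_cst (1 : R) x (1 : R)) dE).
have := @is_deriveV _ (fun y : R => 1 + expR (- y)) x _ 1 (lt0r_neq0 (logistic_den_gt0 x)) dD.
rewrite (_ : _ *: _ = logistic x * (1 - logistic x)) //.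
rewrite /GRing.scale /= /logistic.
by field; rewrite lt0r_neq0 // logistic_den_gt0.
Qed.

Lemma smooth_logistic (q : R -> R) : smooth q -> smooth (logistic \o q).
Proof.
move=> sq.
have d (t : R) : is_derive t 1 (logistic \o q)
    (logistic (q t) * (1 - logistic (q t)) * derive1 q t).
  apply: is_derive1_comp; first exact: is_derive_logistic.
  by rewrite derive1E; apply/derivableP; exact: (sq 0%N).
have dl : derive1 (logistic \o q) =
    fun t => (logistic \o q) t * (1 + (-1) * (logistic \o q) t) * derive1 q t.
  apply/funext => t; rewrite derive1E.
  by rewrite (@derive_val _ _ _ _ _ _ _ (d t)) mulN1r.
have dq t : derivable (logistic \o q) t 1 by have [] := d t.
apply/smoothP => n; elim: n => [|n IH]; first by split.
split; first exact: dq.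
rewrite -/(ndiff n (derive1 (logistic \o q))) dl.
have nc c := (smoothP _).1 (@smooth_cst R c) n.
have nq' := (smoothP _).1 (smooth_derive1 sq) n.
exact: (ndiffM (ndiffM IH (ndiffD (nc 1) (ndiffM (nc (-1)) IH))) nq').
Qed.

Lemma logistic_cvg0 (x : R) : x < 0 -> logistic (n%:R * x) @[n --> \oo] --> (0 : R).
Proof.
move=> x0.
apply: (@squeeze_cvgr _ _ _ _ (fun=> 0) (fun n => expR x ^+ n)).
- apply: nearW => n; rewrite logistic_ge0 /=.
  by rewrite -expRM_natl logistic_le_expR.
- exact: cvg_cst.
- by apply: cvg_expr; rewrite ger0_norm ?expR_ge0 // expR_lt1.
Qed.

Lemma logistic_cvg1 (x : R) : 0 < x -> logistic (n%:R * x) @[n --> \oo] --> (1 : R).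
Proof.
move=> x0.
have := @logistic_cvg0 (- x); rewrite oppr_lt0 => /(_ x0) H.
have -> : (fun n => logistic (n%:R * x)) = (fun n => 1 - logistic (n%:R * - x)).
  by apply/funext => n; rewrite subr1_logistic mulrN opprK.
by rewrite -[X in _ --> X](subr0 (1:R)); apply: cvgB => //; exact: cvg_cst.
Qed.

(** For [0 < x < pi] this is positive on the circle exactly on the open arc of angles between [0]
and [2 * x]: by [arc_test_circ] it is a product of two sines that change sign at
the two endpoints only. *)
Definition arc_test (x : R) (p : circle R) : R :=
  cos x * (sval p).1 + sin x * (sval p).2 - cos x.

Lemma smooth_arc_test x : smoothS (arc_test x).
Proof.
have [sc ss] := smooth_cos_sin R.
have H := @smoothD _ _ _ (@smoothD _ _ _ (@smoothM _ _ _ (@smooth_cst _ (cos x)) sc)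
  (@smoothM _ _ _ (@smooth_cst _ (sin x)) ss)) (@smooth_cst _ (- cos x)).
exact H.
Qed.

Lemma arc_test_circ x t : arc_test x (circ t) = 2 * (sin (t / 2) * sin (x - t / 2)).
Proof.
rewrite /arc_test /=.
have ct : cos t = cos (t / 2) * cos (t / 2) - sin (t / 2) * sin (t / 2).
  by rewrite -cosD -splitr.
have st : sin t = sin (t / 2) * cos (t / 2) + cos (t / 2) * sin (t / 2).
  by rewrite -sinD -splitr.
rewrite ct st sinB.
have := cos2Dsin2 (t / 2).
set a := cos (t / 2); set b := sin (t / 2) => ab.
have -> : a * a = 1 - b ^+ 2 by rewrite -ab; ring.
by ring.
Qed.

Lemma arc_test_gt0 x t : 0 < t -> t < 2 * x -> x < pi -> 0 < arc_test x (circ t).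
Proof.
move=> t0 tx xpi; rewrite arc_test_circ; apply: mulr_gt0 => //; apply: mulr_gt0.
  by apply: sin_gt0_pi; lra.
by apply: sin_gt0_pi; lra.
Qed.

Lemma arc_test_lt0 x t : 0 < x -> 2 * x < t -> t < 2 * pi -> arc_test x (circ t) < 0.
Proof.
move=> x0 xt tpi; rewrite arc_test_circ pmulr_rlt0 //.
rewrite -[x - _]opprB sinN mulrN oppr_lt0; apply: mulr_gt0.
  by apply: sin_gt0_pi; lra.
by apply: sin_gt0_pi; lra.
Qed.

Lemma ae_neq (a : R) : {ae mu, forall t, t <> a}.
Proof.
exists [set a]; split => //; first exact: lebesgue_measure_set1.
by move=> t /= /contrapT.
Qed.

Lemma ae_angles_oo : {ae mu, forall t, (@angles R) t -> 0 < t < 2 * pi}.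
Proof.
move: (ae_neq 0) (ae_neq (2 * pi)).
apply: (@filterS2 _ _ (ae_filter_ringOfSetsType mu)) => t t0 tpi.
rewrite /angles /= in_itv /= => /andP[H1 H2].
by rewrite !lt_neqAle H1 H2 !andbT eq_sym; apply/andP; split; apply/eqP.
Qed.

(** Logistic functions of multiples of [arc_test (x / 2)] are admissible test
functions bounded by [1] that converge almost everywhere on a period to the
indicator of the angles at most [x]. *)
Lemma int_arc_eq0 (h : R -> R) : mu.-integrable (@angles R) (EFin \o h) ->
  (forall phi : circle R -> R, smoothS phi ->
    \int[mu]_(t in @angles R) (h t * phi (circ t)) = 0) ->
  forall x, 0 < x -> x < 2 * pi ->
  \int[mu]_(t in `]-oo, x]) (h \_ (@angles R)) t = 0.
Proof.
move=> ih h0 x x0 xpi.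
have mA := @measurable_angles R.
have mh := measurable_int _ ih.
rewrite -Rintegral_mkcondr setIC Rintegral_mkcondr.
pose phi n (p : circle R) := logistic (n%:R * arc_test (x / 2) p).
have sphi n : smoothS (phi n).
  apply: (@smooth_logistic (fun t => n%:R * arc_test (x / 2) (circ t))).
  exact: (@smoothM _ _ _ (@smooth_cst _ n%:R) (@smooth_arc_test (x / 2))).
pose g n t := (h t * phi n (circ t))%:E.
pose k := h \_ `]-oo, x].
have phi1 n t : `|phi n (circ t)| <= 1.
  by rewrite ger0_norm ?logistic_le1 ?logistic_ge0.
have mg n : measurable_fun (@angles R : set (measurableTypeR R)) (g n).
  apply: (measurable_int _ (integrable_EFinM mA ih _ (fun t _ => phi1 n t))).
  exact: (@smooth_measurable R _ _ (sphi n)).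
have mk : measurable_fun (@angles R : set (measurableTypeR R)) (EFin \o k).
  apply/measurable_EFinP; apply/measurable_restrict => //.
  apply: measurable_funS mA _ _; first by move=> t [].
  exact/measurable_EFinP.
have gk : {ae mu, forall t, (@angles R) t -> g n t @[n --> \oo] --> (EFin \o k) t}.
  move: ae_angles_oo (ae_neq x); apply: (@filterS2 _ _ (ae_filter_ringOfSetsType mu)) => t.
  move=> /[swap] tx /[swap] It /(_ It) /andP[t0 tpi].
  apply: cvg_EFin; first exact: nearW.
  rewrite /k /patch /= mem_setE in_itv /=.
  have [lt_tx|lt_xt|//] := ltgtP t x.
  - rewrite -[X in _ --> X]mulr1; apply: cvgMr; apply: logistic_cvg1.
    by apply: arc_test_gt0; lra.
  - rewrite -[X in _ --> X](mulr0 (h t)); apply: cvgMr; apply: logistic_cvg0.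
    by apply: arc_test_lt0; lra.
have gh : {ae mu, forall t n, (@angles R) t -> (`|g n t| <= `|(EFin \o h) t|)%E}.
  apply: aeW => t n _; rewrite lee_fin normrM.
  by rewrite -[leRHS]mulr1 ler_wpM2l // phi1.
have [ik _ cg] := dominated_convergence mA mg mk gk (integrable_abse ih) gh.
have : 0 @[_ --> \oo] --> \int[mu]_(t in @angles R) k t.
  have -> : (fun=> 0) = (fun n => fine (\int[mu]_(t in @angles R) g n t)).
    by apply/funext => n; rewrite -[LHS](h0 _ (sphi n)).
  apply: fine_cvg; rewrite /Rintegral fineK; first exact: cg.
  exact: (integrable_fin_num mA ik).
by move=> /(cvg_unique (@Rhausdorff R) (cvg_cst _)) <-.
Qed.

(** The primitive of [h] is zero on a period by [int_arc_eq0], and by Lebesgue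
differentiation [h] is almost everywhere its derivative. *)
Lemma circle_test_ae0 (h : R -> R) : mu.-integrable (@angles R) (EFin \o h) ->
  (forall phi : circle R -> R, smoothS phi ->
    \int[mu]_(t in @angles R) (h t * phi (circ t)) = 0) ->
  {ae mu, forall t, (@angles R) t -> h t = 0}.
Proof.
move=> ih h0.
have mA := @measurable_angles R.
have loc := integrable_locally mA ih.
have ihT : mu.-integrable setT (EFin \o (h \_ (@angles R))).
  have := (@integrable_mkcond _ _ _ mu _ (EFin \o h) mA).1 ih.
  by rewrite restrict_EFin.
have ihy y : mu.-integrable `]-oo, y] (EFin \o (h \_ (@angles R))).
  exact: (@integrableS _ _ _ mu _ _ _ measurableT (measurable_itv _) (@subsetT _ _) ihT).
have := FTC1Ny ihy loc.
apply: (@filterS2 _ _ (ae_filter_ringOfSetsType mu)) ae_angles_oo => t ot /= [_ dF] It.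
have /andP[t0 tpi] := ot It.
have := dF; rewrite derive1E patchE mem_set // => <-.
rewrite (_ : 'D_1 _ t = 'D_1 (cst 0 : R -> R) t); first exact: derive_cst.
apply: near_eq_derive.
have : \forall x \near t, x \in `]0, (2 * pi)[.
  by apply: near_in_itvoo; rewrite in_itv /= t0 tpi.
by apply: filterS => x; rewrite in_itv /= => /andP[x0 xpi]; exact: int_arc_eq0.
Qed.

End Fundamental.

(** * The Levi-Civita connection in the frame e *)

Section Circle.
Variable R : realType.
Notation mu := (@lebesgue_measure R).
Notation e := (@unit_field R).
Implicit Types (f h phi : circle R -> R).

Lemma vol_density1 (t : R) : vol_density t = 1.
Proof.
rewrite /vol_density /circ_velocity /g_metric /= !derive1E !derive_val.
by rewrite mulrNN -!expr2 addrC cos2Dsin2 sqrtr1.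
Qed.

Lemma integralSE h :
  integralS h = (\int[mu]_(t in @angles R) (h (circ t))%:E)%E.
Proof. by rewrite /integralS; apply: eq_integral => t _; rewrite vol_density1 mulr1. Qed.

Lemma integrableSE h :
  Defs.integrableS h <-> mu.-integrable (@angles R) (EFin \o (h \o @circ R)).
Proof.
rewrite /Defs.integrableS; have -> : (fun t => (h (circ t) * vol_density t)%:E) =
  EFin \o (h \o @circ R) => //.
by apply/funext => t; rewrite vol_density1 mulr1.
Qed.

Lemma circ_periodic (t : R) : circ (t + 2 * pi) = circ t.
Proof.
by apply: val_inj; rewrite /= mulr_natl cosD2pi sinD2pi.
Qed.

Lemma periodic_circ phi : periodic (phi \o @circ R) (2 * pi).
Proof. by move=> t; rewrite /= circ_periodic. Qed.

Lemma vscale1 : vscale (fun=> 1) e = e.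
Proof. by apply/funext => q; rewrite /vscale !mul1r; case: (e q). Qed.

Lemma vfield_unit : vfield e.
Proof. by rewrite -vscale1; apply: vfield_scale; exact: smooth_cst. Qed.

Lemma dirD_unit_circ phi : smoothS phi ->
  dirD e phi \o @circ R = derive1 (phi \o @circ R).
Proof.
by move=> sphi; apply/funext => t /=; rewrite dirD_circ // /ecoord g_metric_unit mul1r.
Qed.

Definition vzero : circle R -> R * R := fun=> (0, 0).

Lemma vscale0 phi : vscale phi vzero = vzero.
Proof. by apply/funext => q; rewrite /vscale /= !mulr0. Qed.

Lemma vfield_zero : vfield vzero.
Proof.
split; [|exact: smooth_cst..].
by move=> p; rewrite /g_metric /= !mul0r addr0.
Qed.

Lemma dirD_zero phi : dirD vzero phi = fun=> 0.
Proof.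
apply/funext => p; rewrite /dirD /g_metric /=.
under eq_fun do rewrite !mul0r addr0 mul0r.
exact: derive1_cst.
Qed.

Variable nabla : connection R.
Hypothesis lc : levi_civita nabla.

(** Metric compatibility applied to the constant function [g(e, e)] shows that
[nabla e e] is orthogonal to [e]; being tangent, it is zero. *)
Lemma nabla_unit : nabla e e = vzero.
Proof.
have ve := vfield_unit; have vne := lc_vfield lc ve ve.
rewrite (vfieldE vne) -(vscale0 (fun=> 1)).
have -> : ecoord (nabla e e) = fun=> 0.
  have := lc_metric lc ve ve ve.
  rewrite (_ : (fun p => g_metric (e p) (e p)) = fun=> 1); last first.
    by apply/funext => p; exact: g_metric_unit.
  have -> : dirD e (fun=> 1) = fun=> 0.
    by apply/funext => p; rewrite /dirD derive1_cst.
  move=> H; apply/funext => p; rewrite /ecoord.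
  have := congr1 (@^~ p) H => /=.
  rewrite [g_metric (e p) _](_ : _ = g_metric (nabla e e p) (e p)).
    by lra.
  by rewrite /g_metric mulrC [X in _ + X]mulrC.
by apply/funext => p; rewrite /vscale /vzero /= !mul0r mul1r.
Qed.

Lemma nabla_zero u : vfield u -> nabla u vzero = vzero.
Proof.
move=> vu; have := lc_addr lc vu vfield_zero vfield_zero.
have -> : vadd vzero vzero = vzero.
  by apply/funext => p; rewrite /vadd /vzero /= addr0.
move=> H; apply/funext => p; have := congr1 (@^~ p) H.
rewrite /vadd /vzero; case: (nabla u _ p) => a b /= [Ha Hb].
by congr (_, _); lra.
Qed.

Lemma divergence_zero : divergence nabla vzero = fun=> 0.
Proof.
apply/funext => p; rewrite /divergence nabla_zero; last exact: vfield_unit.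
by rewrite /g_metric /= !mul0r addr0.
Qed.

Lemma divergence_unit phi : smoothS phi ->
  divergence nabla (vscale phi e) = dirD e phi.
Proof.
move=> sphi; apply/funext => p; have ve := vfield_unit.
rewrite /divergence lc_leibniz // nabla_unit vscale0.
transitivity (ecoord (vscale (dirD e phi) e) p); last by rewrite ecoord_scale.
by rewrite /ecoord /g_metric /vadd /vzero /= !addr0.
Qed.

End Circle.

(** * Almost everywhere uniqueness of weak derivatives *)

Section WeakDerivatives.
Variable R : realType.
Notation mu := (@lebesgue_measure R).
Notation e := (@unit_field R).
Implicit Types (f h : circle R -> R) (F W : R -> R).

Lemma integral_EFin F : mu.-integrable (@angles R) (EFin \o F) ->
  (\int[mu]_(t in @angles R) (F t)%:E = (\int[mu]_(t in @angles R) F t)%:E)%E.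
Proof.
by move=> iF; rewrite /Rintegral fineK // (integrable_fin_num (@measurable_angles R) iF).
Qed.

Lemma integrable_smoothM F phi : mu.-integrable (@angles R) (EFin \o F) ->
  smooth phi -> mu.-integrable (@angles R) (EFin \o (fun t => F t * phi t)).
Proof.
move=> iF sphi; have [M HM] := smooth_bounded sphi.
exact: (integrable_EFinM (@measurable_angles R) iF (@smooth_measurable R _ _ sphi) HM).
Qed.

(** Needed because the inner derivative of an iterated weak derivative is an
arbitrary representative of its class. *)
Lemma wderiv_ae_eq F F' W : wderiv F W ->
  mu.-integrable (@angles R) (EFin \o F') ->
  {ae mu, forall t, (@angles R) t -> F t = F' t} -> wderiv F' W.
Proof.
move=> [iF iW FW] iF' FF'; split => // phi sphi pphi; rewrite FW //; congr (- _).
have sphi' := smooth_derive1 sphi.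
have m1 := measurable_int _ (integrable_smoothM iF sphi').
have m2 := measurable_int _ (integrable_smoothM iF' sphi').
congr fine; apply: (@ae_eq_integral _ _ _ mu _ _ _ (@measurable_angles R) m1 m2).
by move: FF'; apply: (filterS (Filter := ae_filter_ringOfSetsType mu)) => t /[apply] /= ->.
Qed.

Lemma circle_test_ae_eq W1 W2 :
  mu.-integrable (@angles R) (EFin \o W1) -> mu.-integrable (@angles R) (EFin \o W2) ->
  (forall phi, smoothS phi ->
    \int[mu]_(t in @angles R) (W1 t * phi (circ t)) =
    \int[mu]_(t in @angles R) (W2 t * phi (circ t))) ->
  {ae mu, forall t, (@angles R) t -> W1 t = W2 t}.
Proof.
move=> i1 i2 W12; have mA := @measurable_angles R.
have := circle_test_ae0 (integrable_EFinB mA i1 i2).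
have H phi : smoothS phi ->
    \int[mu]_(t in @angles R) ((W1 t - W2 t) * phi (circ t)) = 0.
  move=> sphi.
  have -> : (fun t => (W1 t - W2 t) * phi (circ t)) =
      (fun t => W1 t * (phi \o @circ R) t - W2 t * (phi \o @circ R) t).
    by apply/funext => t; rewrite mulrBl.
  rewrite RintegralB //; [|exact: integrable_smoothM..].
  by rewrite W12 // subrr.
move=> /(_ H); apply: (filterS (Filter := ae_filter_ringOfSetsType mu)) => t /[apply] /eqP.
by rewrite subr_eq0 => /eqP.
Qed.

Variable nabla : connection R.
Hypothesis lc : levi_civita nabla.

Lemma is_wdirD_unit f h :
  wderiv (f \o @circ R) (h \o @circ R) -> is_wdirD nabla e f h.
Proof.
move=> [iF iH FH]; split; [exact/integrableSE..|].
move=> phi sphi; rewrite divergence_unit // !integralSE.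
have := FH _ sphi (periodic_circ phi).
rewrite (integral_EFin (integrable_smoothM iH sphi)) => ->.
have -> : (fun t => (f (circ t) * dirD e phi (circ t))%:E) =
    fun t => ((f \o @circ R) t * derive1 (phi \o @circ R) t)%:E.
  apply/funext => t; congr (_ * _)%:E.
  exact: (congr1 (@^~ t) (dirD_unit_circ sphi)).
by rewrite (integral_EFin (integrable_smoothM iF (smooth_derive1 sphi))) EFinN.
Qed.

Lemma is_wdirD_zero f : Defs.integrableS f -> is_wdirD nabla (@vzero R) f (fun=> 0).
Proof.
move=> iF; split => //.
  by apply/integrableSE; exact: (smooth_integrable (@smooth_cst R 0)).
move=> phi sphi; rewrite vscale0 divergence_zero // !integralSE.
under eq_integral do rewrite mul0r.
by under [in RHS]eq_integral do rewrite mulr0; rewrite integral0 oppe0.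
Qed.

(** Whatever representative is chosen for the weak directional derivative, it
agrees almost everywhere with any given one. *)
Lemma wdirD_ae v f h : is_wdirD nabla v f h ->
  mu.-integrable (@angles R) (EFin \o (wdirD nabla v f \o @circ R)) /\
  {ae mu, forall t, (@angles R) t -> h (circ t) = wdirD nabla v f (circ t)}.
Proof.
move=> fh.
have [_ iw fw] : is_wdirD nabla v f (wdirD nabla v f)
  by exact: (xgetPex (fun=> 0) (ex_intro _ h fh)).
move: fh => [_ ih fh].
have /integrableSE iw' := iw; have /integrableSE ih' := ih.
split => //; apply: circle_test_ae_eq => // phi sphi.
have := fh _ sphi; rewrite -fw // !integralSE.
rewrite (integral_EFin (integrable_smoothM ih' sphi)).
by rewrite (integral_EFin (integrable_smoothM iw' sphi)) => -[].
Qed.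

(** The correction term of the Hessian is a weak derivative along
[nabla e e = 0], hence zero almost everywhere. *)
Lemma weak_hessian_ae f h k :
  wderiv (f \o @circ R) (h \o @circ R) -> wderiv (h \o @circ R) (k \o @circ R) ->
  let H := hessian nabla (wdirD nabla) f e e \o @circ R in
  measurable_fun (@angles R) (H : measurableTypeR R -> R) /\
  {ae mu, forall t, (@angles R) t -> k (circ t) = H t}.
Proof.
move=> fh hk H.
have [iw hw] := wdirD_ae (is_wdirD_unit fh).
have [iw2 kw] := wdirD_ae (is_wdirD_unit (wderiv_ae_eq hk iw hw)).
have if_ : Defs.integrableS f by apply/integrableSE; case: fh.
have [i0 w0] := wdirD_ae (is_wdirD_zero if_).
rewrite -(nabla_unit lc) in i0 w0.
split.
  have := integrable_EFinB (@measurable_angles R) iw2 i0.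
  by move=> /(measurable_int _) /measurable_EFinP.
move: kw w0; apply: (@filterS2 _ _ (ae_filter_ringOfSetsType mu)) => t kt wt It.
by rewrite kt // /H /hessian /= -wt // subr0.
Qed.

(** The function [V] is the weak derivative selected in the definition of the
length. *)
Lemma curve_length_ae D (f : circle R -> 'rV[R]_D) (W : R -> 'rV[R]_D) :
  (forall j, wderiv (fun t => f (circ t) ord0 j) (fun t => W t ord0 j)) ->
  exists V : R -> 'rV[R]_D,
  [/\ curve_length f = (\int[mu]_(t in @angles R) (enorm (V t))%:E)%E,
      forall j, measurable_fun (@angles R) ((fun t => V t ord0 j) : measurableTypeR R -> R) &
      forall j, {ae mu, forall t, (@angles R) t -> W t ord0 j = V t ord0 j}].
Proof.
move=> fW.
have wW : is_wderiv (f \o @circ R) W.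
  move=> j; have [iF iW FW] := fW j; split => // phi sphi pphi.
  rewrite (integral_EFin (integrable_smoothM iW sphi)) FW //.
  by rewrite (integral_EFin (integrable_smoothM iF (smooth_derive1 sphi))) EFinN.
pose V := xget (fun=> 0 : 'rV[R]_D) [set W : R -> 'rV[R]_D | is_wderiv (f \o @circ R) W].
have wV : is_wderiv (f \o @circ R) V by exact: (xgetPex (fun=> 0) (ex_intro _ W wW)).
exists V; split.
- by rewrite /curve_length -/V; case: asboolP.
- by move=> j; have [_ /(measurable_int _) /measurable_EFinP iV _] := wV j.
move=> j; have [_ iW HW] := wW j; have [_ iV HV] := wV j.
apply: circle_test_ae_eq => // phi sphi.
have := HW _ sphi (periodic_circ phi); rewrite -HV //; last exact: periodic_circ.
rewrite (integral_EFin (integrable_smoothM iW sphi)).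
by rewrite (integral_EFin (integrable_smoothM iV sphi)) => -[].
Qed.

End WeakDerivatives.

(** * Comparison of L1 and L2 norms *)

Section SqrtEreal.
Variable R : realType.

Lemma le_poweR_half_lt (x : \bar R) (c : R) : (0 <= x)%E ->
  (x `^ 2^-1 < c%:E)%E -> (x <= (c ^+ 2)%:E)%E.
Proof.
case: x => [x| |] // x0; last by rewrite poweRyr // invr_eq0 pnatr_eq0.
  rewrite lee_fin in x0; rewrite poweR_EFin lee_fin lte_fin powR12_sqrt // => xc.
  rewrite -(sqr_sqrtr x0) ler_pXn2r // ?nnegrE ?sqrtr_ge0 //.
    exact: ltW.
  by rewrite (le_trans _ (ltW xc)) // sqrtr_ge0.
Qed.

Lemma sqr_poweR_half (x : \bar R) : (0 <= x)%E -> ((x `^ 2^-1) ^+ 2 = x)%E.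
Proof.
case: x => [x| |] // x0.
  rewrite lee_fin in x0; by rewrite poweR_EFin powR12_sqrt // -EFin_expe sqr_sqrtr.
by rewrite poweRyr ?invr_eq0 ?pnatr_eq0 // expe2 mulyy.
Qed.

End SqrtEreal.

Section L1L2.
Variable R : realType.
Notation mu := (@lebesgue_measure R).
Implicit Types (F : R -> R).

(** Integrate the inequality [2 |F| <= c + F^2 / c].  This gives integrability
of [F] at the same time as the bound. *)
Lemma L1_le_of_L2_le F (c : R) : 0 < c ->
  measurable_fun (@angles R) (F : measurableTypeR R -> R) ->
  (\int[mu]_(t in @angles R) (F t ^+ 2)%:E <= (c ^+ 2)%:E)%E ->
  mu.-integrable (@angles R) (EFin \o F) /\
  \int[mu]_(t in @angles R) `|F t| <= (2 * pi + 1) / 2 * c.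
Proof.
move=> c0 mF F2; have mA := @measurable_angles R.
have mF2 : measurable_fun (@angles R : set (measurableTypeR R)) (fun t => F t ^+ 2).
  exact: measurable_funX.
have iF2 : mu.-integrable (@angles R) (EFin \o (fun t => F t ^+ 2)).
  apply/integrableP; split; first exact/measurable_EFinP.
  under eq_integral do rewrite gee0_abs ?lee_fin ?sqr_ge0 //.
  by apply: le_lt_trans F2 _; rewrite ltry.
pose g t := c / 2 + (2 * c)^-1 * F t ^+ 2.
have Fg t : `|F t| <= g t.
  rewrite /g -(real_normK (num_real (F t))).
  rewrite -subr_ge0.
  have -> : c / 2 + (2 * c)^-1 * `|F t| ^+ 2 - `|F t| = (2 * c)^-1 * (c - `|F t|) ^+ 2.
    by field; rewrite lt0r_neq0.
  by rewrite mulr_ge0 ?sqr_ge0 // invr_ge0 mulr_ge0 // ltW.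
have i1 : mu.-integrable (@angles R) (EFin \o (fun _ : R => c / 2)).
  exact: (smooth_integrable (@smooth_cst R _)).
have i2 : mu.-integrable (@angles R) (EFin \o (fun t => (2 * c)^-1 * F t ^+ 2)).
  by have := @integrableZl _ _ _ mu _ mA ((2 * c)^-1) _ iF2.
have ig : mu.-integrable (@angles R) (EFin \o g).
  by have := integrableD mA i1 i2.
have iF : mu.-integrable (@angles R) (EFin \o F).
  apply: (le_integrable mA _ _ ig); first exact/measurable_EFinP.
  by move=> t _; rewrite lee_fin (le_trans (Fg t)) // ler_norm.
split => //.
apply: (@le_trans _ _ (\int[mu]_(t in @angles R) g t)).
  by apply: le_Rintegral => //; exact: integrable_EFin_norm.
rewrite RintegralD // Rintegral_angles_cst RintegralZl //.
have : \int[mu]_(t in @angles R) (F t ^+ 2) <= c ^+ 2.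
  by rewrite -lee_fin -integral_EFin.
move=> H; apply: (@le_trans _ _ (c / 2 * (2 * pi) + (2 * c)^-1 * c ^+ 2)).
  by rewrite lerD2l ler_wpM2l // invr_ge0 mulr_ge0 // ltW.
rewrite le_eqVlt; apply/orP; left; apply/eqP.
by field; rewrite lt0r_neq0.
Qed.

(** Cauchy-Schwarz against the constant [1], obtained by integrating
[2 c |F| <= c^2 + F^2] for [c] the mean value of [|F|]. *)
Lemma sqr_L1_le_L2 F : mu.-integrable (@angles R) (EFin \o F) ->
  (((\int[mu]_(t in @angles R) `|F t|) ^+ 2)%:E <=
   (2 * pi)%:E * \int[mu]_(t in @angles R) (F t ^+ 2)%:E)%E.
Proof.
move=> iF; have mA := @measurable_angles R; have pi0 := twopi_gt0 R.
have /measurable_EFinP mF := measurable_int _ iF.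
have mF2 : measurable_fun (@angles R : set (measurableTypeR R)) (fun t => F t ^+ 2).
  exact: measurable_funX.
have B0 : (0 <= \int[mu]_(t in @angles R) (F t ^+ 2)%:E)%E.
  by apply: integral_ge0 => t _; rewrite lee_fin sqr_ge0.
have [Boo|Bfin] := eqVneq (\int[mu]_(t in @angles R) (F t ^+ 2)%:E)%E +oo%E.
  by rewrite Boo gt0_muley ?lte_fin // leey.
have iF2 : mu.-integrable (@angles R) (EFin \o (fun t => F t ^+ 2)).
  apply/integrableP; split; first exact/measurable_EFinP.
  under eq_integral do rewrite gee0_abs ?lee_fin ?sqr_ge0 //.
  by rewrite ltey.
rewrite integral_EFin // -EFinM lee_fin.
set A := \int[mu]_(t in @angles R) `|F t|; set B := \int[mu]_(t in @angles R) (F t ^+ 2).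
have iN := integrable_EFin_norm iF.
(* The optimal constant in the quadratic inequality is the mean of [|F|]. *)
pose c := A / (2 * pi).
have i1 : mu.-integrable (@angles R) (EFin \o (fun _ : R => c ^+ 2)).
  exact: (smooth_integrable (@smooth_cst R _)).
have : \int[mu]_(t in @angles R) (2 * c * `|F t|) <= \int[mu]_(t in @angles R) (c ^+ 2 + F t ^+ 2).
  apply: le_Rintegral => //.
  - by have := @integrableZl _ _ _ mu _ mA (2 * c) _ iN.
  - by have := integrableD mA i1 iF2.
  - move=> t _; rewrite -(real_normK (num_real (F t))) -subr_ge0.
    have -> : c ^+ 2 + `|F t| ^+ 2 - 2 * c * `|F t| = (c - `|F t|) ^+ 2 by ring.
    exact: sqr_ge0.
rewrite RintegralZl // RintegralD // Rintegral_angles_cst -/A -/B => H.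
have -> : A = c * (2 * pi) by rewrite /c divfK // lt0r_neq0.
have {}H : 2 * c * (c * (2 * pi)) <= c ^+ 2 * (2 * pi) + B.
  by move: H; rewrite (_ : A = c * (2 * pi)) // /c divfK // lt0r_neq0.
have : c ^+ 2 * (2 * pi) <= B by lra.
move=> /(ler_wpM2l (ltW pi0)); apply: le_trans.
by rewrite le_eqVlt; apply/orP; left; apply/eqP; ring.
Qed.

End L1L2.

(** * Weak derivatives of maps in H2 *)

Section Main.
Variables (R : realType) (D : nat) (nabla : connection R).
Hypothesis lc : levi_civita nabla.
Notation mu := (@lebesgue_measure R).
Notation e := (@unit_field R).
Implicit Types (f Q : circle R -> 'rV[R]_D).

Lemma enorm_sqr (x : 'rV[R]_D) : enorm x ^+ 2 = \sum_j x ord0 j ^+ 2.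
Proof. by rewrite sqr_sqrtr // sumr_ge0 // => j _; exact: sqr_ge0. Qed.

Lemma measurable_enorm_sqr (W : R -> 'rV[R]_D) :
  (forall j, measurable_fun (@angles R) ((fun t => W t ord0 j) : measurableTypeR R -> R)) ->
  measurable_fun (@angles R) ((fun t => enorm (W t) ^+ 2) : measurableTypeR R -> R).
Proof.
move=> mW; rewrite (_ : (fun t => _) = fun t => \sum_j W t ord0 j ^+ 2); last first.
  by apply/funext => t; rewrite enorm_sqr.
by apply: measurable_sum => j; exact: measurable_funX.
Qed.

Lemma L2norm_component_L1 Q (c : R) (j : 'I_D) : 0 < c ->
  (forall i, measurable_fun (@angles R)
     ((fun t => Q (circ t) ord0 i) : measurableTypeR R -> R)) ->
  (L2norm Q < c%:E)%E ->
  mu.-integrable (@angles R) (EFin \o (fun t => Q (circ t) ord0 j)) /\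
  \int[mu]_(t in @angles R) `|Q (circ t) ord0 j| <= (2 * pi + 1) / 2 * c.
Proof.
move=> c0 mQ Qc; apply: L1_le_of_L2_le => //.
rewrite /L2norm integralSE in Qc.
apply: le_trans (le_poweR_half_lt _ Qc); last first.
  by apply: integral_ge0 => t _; rewrite lee_fin sqr_ge0.
apply: ge0_le_integral => //.
- exact: measurable_angles.
- by move=> t _; rewrite lee_fin sqr_ge0.
- by apply/measurable_EFinP; apply: measurable_funX; exact: mQ.
- by apply/measurable_EFinP; exact: measurable_enorm_sqr.
- move=> t _; rewrite lee_fin enorm_sqr (bigD1 j) //= lerDl sumr_ge0 // => i _.
  exact: sqr_ge0.
Qed.

Lemma hessian_dirD_circ (phi : circle R -> R) t : smoothS phi ->
  hessian nabla (@dirD R) phi e e (circ t) = derive1 (derive1 (phi \o @circ R)) t.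
Proof.
move=> sphi; rewrite /hessian nabla_unit // dirD_zero subr0.
have sd := smoothS_dirD (vfield_unit R) sphi.
rewrite -(dirD_unit_circ sphi).
exact: (congr1 (@^~ t) (dirD_unit_circ sd)).
Qed.

Lemma H2norm_component_L1 Q (c : R) (j : 'I_D) : 0 < c -> smooth_map Q ->
  (H2norm nabla Q < c%:E)%E ->
  \int[mu]_(t in @angles R)
     `|derive1 (derive1 (fun t => Q (circ t) ord0 j)) t| <= (2 * pi + 1) / 2 * c.
Proof.
move=> c0 sQ Qc.
have s2 i := smooth_derive1 (smooth_derive1 (sQ i)).
have [] // := @L1_le_of_L2_le R (derive1 (derive1 (fun t => Q (circ t) ord0 j))) c c0.
  exact: (smooth_measurable (s2 j)).
pose S i := integralS (fun p => hessian nabla (@dirD R) (fun q => Q q ord0 i) e e p ^+ 2).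
have S0 i : (0 <= S i)%E.
  by rewrite /S integralSE; apply: integral_ge0 => t _; rewrite lee_fin sqr_ge0.
have -> : (\int[mu]_(t in @angles R)
    (derive1 (derive1 (fun t => Q (circ t) ord0 j)) t ^+ 2)%:E)%E = S j.
  rewrite /S integralSE; apply: eq_integral => t _.
  by rewrite hessian_dirD_circ //; exact: sQ.
rewrite /H2norm in Qc.
apply: le_trans (le_poweR_half_lt _ Qc); last by rewrite adde_ge0 // expe_ge0 // poweR_ge0.
rewrite /hess_L2norm sqr_poweR_half; last by apply: sume_ge0 => i _; exact: S0.
apply: (@le_trans _ _ (\sum_i S i)%E).
  by rewrite (bigD1 j) //= leeDl // sume_ge0.
by rewrite leeDr // expe_ge0 // poweR_ge0.
Qed.

(** The smooth maps approximating [f] are replaced by a subsequence with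
increments smaller than [2^-k] in the [H^2] norm, whose first and second
derivatives then converge in [L^1]. *)
Lemma inH2_weak_derivatives f (j : 'I_D) : inH2 nabla f ->
  exists h k : circle R -> R,
  [/\ wderiv (fun t => f (circ t) ord0 j) (h \o @circ R),
      wderiv (h \o @circ R) (k \o @circ R) &
      {ae mu, forall t, (@angles R) t ->
         `|h (circ t)| <= \int[mu]_(s in @angles R) `|k (circ s)|}].
Proof.
move=> [[mf f2] [F [sF cauF Ff]]].
have mf' i : measurable_fun (@angles R)
    ((fun t => f (circ t) ord0 i) : measurableTypeR R -> R) by exact: mf.
have /choice[N HN] k : exists N, forall m n, (N <= m)%N -> (N <= n)%N ->
    (H2norm nabla (fun p => (F m p - F n p)%R) < (2^-1 ^+ k)%:E)%E.
  by apply: cauF; rewrite exprn_gt0 // invr_gt0.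
(* A sum of successors is at least every [N i] occurring in it and at least [k],
   so both the Cauchy estimates and the convergence to [f] are inherited. *)
pose n k := (\sum_(i < k.+1) (N i).+1)%N.
have nN k : (N k <= n k)%N.
  by rewrite /n big_ord_recr /=; apply: leq_trans (leq_addl _ _); exact: leqnSn.
have nS k : (N k <= n k.+1)%N.
  by apply: leq_trans (nN k) _; rewrite /n [leqRHS]big_ord_recr /= leq_addr.
have nk k : (k <= n k)%N.
  elim: k => // k IH; rewrite /n big_ord_recr /= addnS ltnS.
  by apply: leq_trans IH _; rewrite leq_addr.
pose phi k (q : circle R) := F (n k) q ord0 j.
have sphi k : smoothS (phi k) by exact: sF.
pose u k := phi k \o @circ R.
pose K : R := (2 * pi + 1) / 2.
have pi0 := twopi_gt0 R.
have K0 : 0 < K by rewrite /K; lra.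
have mFf m i : measurable_fun (@angles R)
    ((fun t => (F m (circ t) - f (circ t)) ord0 i) : measurableTypeR R -> R).
  under eq_fun do rewrite !mxE.
  by apply: measurable_funB => //; exact: (smooth_measurable (sF m i)).
have L1f (eps : R) : 0 < eps -> \forall k \near \oo,
    mu.-integrable (@angles R) (EFin \o (fun t => u k t - f (circ t) ord0 j)) /\
    \int[mu]_(t in @angles R) `|u k t - f (circ t) ord0 j| <= K * eps.
  move=> eps0.
  have [M _ HM] : \forall m \near \oo, (L2norm (fun p => (F m p - f p)%R) < eps%:E)%E.
    by have := Ff _ (@nbhs_open_ereal_lt R 0 (fun=> eps) eps0).
  exists M => // k /= Mk.
  have := @L2norm_component_L1 (fun p => F (n k) p - f p) eps j eps0 (mFf (n k)).
  rewrite (_ : (fun t => (F (n k) (circ t) - f (circ t)) ord0 j) =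
    fun t => u k t - f (circ t) ord0 j); last by apply/funext => t; rewrite !mxE.
  rewrite (_ : (fun t => `|(F (n k) (circ t) - f (circ t)) ord0 j|) =
    fun t => `|u k t - f (circ t) ord0 j|); last by apply/funext => t; rewrite !mxE.
  by apply; apply: HM; rewrite /= (leq_trans Mk).
have if_ : mu.-integrable (@angles R) (EFin \o (fun t => f (circ t) ord0 j)).
  have [k0 _ /(_ k0 (leqnn _)) [i0 _]] := L1f 1 ltr01.
  have := integrable_EFinB (@measurable_angles R) (smooth_integrable (sphi k0)) i0.
  rewrite (_ : (fun t => _ - _) = fun t => f (circ t) ord0 j) //.
  by apply/funext => t; rewrite subKr.
have uf : \int[mu]_(t in @angles R) `|u k t - f (circ t) ord0 j| @[k --> \oo] --> (0 : R).
  apply/cvgrPdist_le => eps eps0.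
  have := L1f (eps / K) (divr_gt0 eps0 K0); apply: filterS => k [_].
  rewrite mulrC divfK ?lt0r_neq0 // => H.
  by rewrite sub0r normrN ger0_norm // Rintegral_ge0.
pose a1 k := dirD e (phi k); pose a2 k := dirD e (a1 k).
have sa1 k : smoothS (a1 k) := smoothS_dirD (vfield_unit R) (sphi k).
have E1 k : a1 k \o @circ R = derive1 (u k) := dirD_unit_circ (sphi k).
have E2 k : a2 k \o @circ R = derive1 (a1 k \o @circ R) := dirD_unit_circ (sa1 k).
(* From here on only the two equations matter; keeping the bodies would make
   unification unfold the directional derivatives. *)
clearbody a2; clear sa1; clearbody a1.
have u2 k : \int[mu]_(t in @angles R)
     `|(a2 k.+1 \o @circ R) t - (a2 k \o @circ R) t| <= K / 2 ^+ k.
  have := H2norm_component_L1 j _ _ (HN k _ _ (nS k) (nN k)).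
  rewrite -exprVn => H.
  have D2 : derive1 (derive1 (fun t => (F (n k.+1) (circ t) - F (n k) (circ t)) ord0 j)) =
      fun t => (a2 k.+1 \o @circ R) t - (a2 k \o @circ R) t.
    rewrite (E2 k.+1) (E2 k) (E1 k.+1) (E1 k).
    rewrite -(derive1_sub (smooth_derive1 (sphi k.+1)) (smooth_derive1 (sphi k))).
    rewrite -(derive1_sub (sphi k.+1) (sphi k)); congr (derive1 (derive1 _)).
    by apply/funext => t; rewrite !mxE.
  rewrite D2 in H.
  apply: H; first by rewrite exprn_gt0 // invr_gt0.
  move=> i; rewrite /smoothS (_ : _ \o _ = 
    fun t => F (n k.+1) (circ t) ord0 i - F (n k) (circ t) ord0 i).
    exact: (smooth_sub (sF (n k.+1) i) (sF (n k) i)).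
  by apply/funext => t; rewrite /= !mxE.
exists (fun p => fine (limn_esup (fun k => (a1 k p)%:E))),
  (fun p => fine (limn_esup (fun k => (a2 k p)%:E))).
exact: (second_wderiv_limit E1 E2 sphi (fun k => @periodic_circ R (phi k)) if_ uf u2).
Qed.

End Main.

(** * The length estimate *)

Section Final.
Variables (R : realType) (D : nat).
Notation mu := (@lebesgue_measure R).
Notation e := (@unit_field R).

Lemma ae_forall_ord (P : 'I_D -> R -> Prop) :
  (forall j, {ae mu, forall t, P j t}) -> {ae mu, forall t j, P j t}.
Proof.
move=> aeP.
have : {ae mu, forall t (n : nat) (j : 'I_D), j = n :> nat -> P j t}.
  apply: ae_foralln => n; have [nD|Dn] := ltnP n D.
    apply: (filterS (Filter := ae_filter_ringOfSetsType mu)) (aeP (Ordinal nD)) => t Pt j jn.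
    by have -> : j = Ordinal nD by exact: val_inj.
  by apply: aeW => t j jn; move: (ltn_ord j); rewrite jn ltnNge Dn.
by apply: (filterS (Filter := ae_filter_ringOfSetsType mu)) => t H j; exact: (H j j).
Qed.

(** The constant on the right is the integral over one period of the Euclidean
norm of the vector of the [A j]. *)
Lemma integral_enorm_le (V : R -> 'rV[R]_D) (A : 'I_D -> R) :
  (forall j, measurable_fun (@angles R) ((fun t => V t ord0 j) : measurableTypeR R -> R)) ->
  {ae mu, forall t j, (@angles R) t -> `|V t ord0 j| <= A j} ->
  (\int[mu]_(t in @angles R) (enorm (V t))%:E <=
   (Num.sqrt (\sum_j A j ^+ 2) * (2 * pi))%:E)%E.
Proof.
move=> mV VA; have mA := @measurable_angles R.
pose c := Num.sqrt (\sum_j A j ^+ 2).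
have -> : ((c * (2 * pi))%:E = \int[mu]_(t in @angles R) c%:E)%E.
  by rewrite integral_EFin ?Rintegral_angles_cst //; exact: (smooth_integrable (@smooth_cst R c)).
apply: ae_ge0_le_integral => //.
- by move=> t _; rewrite lee_fin sqrtr_ge0.
- apply/measurable_EFinP.
  have -> : (fun t => enorm (V t)) = fun t => Num.sqrt (enorm (V t) ^+ 2).
    by apply/funext => t; rewrite enorm_sqr.
  apply: measurableT_comp; last exact: measurable_enorm_sqr.
  by apply: continuous_measurable_fun; exact: sqrt_continuous.
- by move=> t _; rewrite lee_fin sqrtr_ge0.
apply: (filterS (Filter := ae_filter_ringOfSetsType mu)) VA => t VA It.
rewrite lee_fin ler_sqrt; last by rewrite sumr_ge0 // => j _; exact: sqr_ge0.
apply: ler_sum => j _; rewrite -(real_normK (num_real (V t ord0 j))).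
have H := VA j It; rewrite ler_pXn2r // ?nnegrE //.
exact: le_trans H.
Qed.

End Final.

Theorem mainTheorem4 (R : realType) (D : nat) (nabla : connection R)
    (hnabla : levi_civita nabla)
    (f : circle R -> 'rV[R]_D) (hf : inH2 nabla f) :
  (curve_length f <=
   ((2 * pi) `^ (3 / 2))%:E * hess_L2norm nabla (wdirD nabla) f)%E.
Proof.
pose mu := @lebesgue_measure R.
have mA := @measurable_angles R; have pi0 := twopi_gt0 R.
have /choice[h /choice[k hk]] j := inH2_weak_derivatives hnabla j hf.
pose W t : 'rV[R]_D := \row_j h j (circ t).
have [] := @curve_length_ae R D f W.
  move=> j; have [fh _ _] := hk j.
  by rewrite (_ : (fun t => W t ord0 j) = h j \o @circ R) //; apply/funext => t; rewrite mxE.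
move=> V [-> mV WV].
pose A j := Rintegral mu (@angles R) (fun s => `|k j (circ s)|).
have VA : {ae mu, forall t j, (@angles R) t -> `|V t ord0 j| <= A j}.
  apply: ae_forall_ord => j; have [_ _ hA] := hk j.
  apply: (@filterS2 _ _ (ae_filter_ringOfSetsType mu)) hA (WV j) => t hA WVt It.
  by rewrite -WVt // mxE; exact: hA.
apply: le_trans (integral_enorm_le mV VA) _.
rewrite /hess_L2norm.
pose S j := integralS (fun p => hessian nabla (wdirD nabla) (fun q => f q ord0 j)
  (@unit_field R) (@unit_field R) p ^+ 2).
have S0 j : (0 <= S j)%E.
  by rewrite /S integralSE; apply: integral_ge0 => t _; rewrite lee_fin sqr_ge0.
(* Cauchy-Schwarz in each component, for the chosen representative. *)
have AS j : ((A j ^+ 2)%:E <= (2 * pi)%:E * S j)%E.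
  have [fh hk' _] := hk j; have [_ ik _] := hk'.
  have [mH kH] := @weak_hessian_ae _ _ hnabla (fun q => f q ord0 j) _ _ fh hk'.
  apply: le_trans (sqr_L1_le_L2 ik) _.
  rewrite /S integralSE le_eqVlt; apply/orP; left; apply/eqP; congr (_ * _)%E.
  have /measurable_EFinP mk := measurable_int _ ik.
  apply: ae_eq_integral => //.
  - by apply/measurable_EFinP; exact: measurable_funX.
  - by apply/measurable_EFinP; exact: (measurable_funX _ mH).
  by apply: (filterS (Filter := ae_filter_ringOfSetsType mu)) kH => t /[apply] /= ->.
have {}AS : ((\sum_j A j ^+ 2)%:E <= (2 * pi)%:E * \sum_j S j)%E.
  rewrite ge0_sume_distrr; last by move=> j _; exact: S0.
  by rewrite -sumEFin; apply: lee_sum => j _; exact: AS.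
have : (0 <= \sum_j S j)%E by apply: sume_ge0 => j _; exact: S0.
rewrite -/(S _); move: AS.
case: (\sum_j S j)%E => [s| |] // AS s0; last first.
  by rewrite poweRyr ?invr_eq0 ?pnatr_eq0 // gt0_muley ?leey // lte_fin powR_gt0.
rewrite lee_fin in s0; rewrite -EFinM lee_fin in AS.
rewrite poweR_EFin -EFinM lee_fin powR12_sqrt //.
have -> : (2 * pi) `^ (3 / 2) = (2 * pi) * Num.sqrt (2 * pi) :> R.
  (* One factor [2 * pi] is the length of the interval, the square root comes
     from Cauchy-Schwarz. *)
  have -> : 3 / 2 = 1 + 2^-1 :> R by lra.
  by rewrite powRD ?powRr1 ?powR12_sqrt ?(ltW pi0) // (gt_eqF pi0) implybT.
rewrite [leLHS]mulrC -[leRHS]mulrA ler_wpM2l ?(ltW pi0) // -sqrtrM ?(ltW pi0) //.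
by rewrite ler_sqrt // mulr_ge0 // ltW.
Qed.
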